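(* Consider problem (P) of the context with $h=\iota_{\mathcal X}$ and $g,f_1,\dots,f_m$ twice continuously differentiable. Suppose the Lipschitz/boundedness assumption and the nondegeneracy assumption of the context hold, with $w^*=(x^*,y^*,z^* )$, $J$, $D$, $\mu$ and $\gamma$ as there; moreover assume $\gamma$ is so small that $$\Big|\sum_{j\in J}L_j(\beta f_j(\hat x)+\hat z_j)-\sum_{j\in J}L_j(\beta f_j(\tilde x)+\tilde z_j)\Big|\le\frac\mu8\quad\text{for all }\hat x,\tilde x\in\mathcal B_\gamma(x^* ),\ \hat z,\tilde z\in\mathcal B_\gamma(z^* ).$$ Let $\{w^k\}=\{(x^k,y^k,z^k)\}$ be the sequence generated by LALM (described in the context) with $\rho_y=\rho_z=\frac\beta2$, $\delta>0$, and $w^0$ satisfying $$\|x^0-x^*\|^2+\frac1{\rho_y\underline\eta}\|y^0-y^*\|^2+\frac1{\rho_z\underline\eta}\|z^0-z^*\|^2\le\gamma^2\min\Big(1,\frac1{\rho_y\bar\eta},\frac1{\rho_z\bar\eta}\Big),$$ where $\underline\eta$ and $\bar\eta$ are as in the context. Let $\nu>0$ be the smallest eigenvalue of $D^\top D$, $L_{\max}=\max_jL_j$, and $$C=L_g^2+2|J|\Big(\sum_{j\in J}\beta^2B_j^4+2L_{\max}^2(\|z^*\|^2+\gamma^2)\Big).$$ Then for any $\alpha>0$ such that $$\alpha<\min\Big(\frac\mu{8C},\ \frac\delta{\bar\eta^2},\ \frac1{\beta\|A\|^2}\Big),$$ it holds for every $k\ge0$ that $\phi_{k+1}\le\sigma\,\phi_k$,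 where $$\phi_k=\Big(\frac\mu{16}+\frac{\eta^k}2\Big)\|x^k-x^*\|^2+\frac1\beta\big(\|y^k-y^*\|^2+\|z^k-z^*\|^2\big),\qquad \sigma=\max\Big(\frac{\alpha C+\bar\eta}{\frac\mu8+\bar\eta},\ 1-\frac{\alpha\beta\nu}8\Big)<1.$$
   Context: Problem (P): $\min_{x\in\mathbb R^p} f_0(x):=g(x)+h(x)$ subject to $Ax=b$, $f_j(x)\le 0$ for $j=1,\dots,m$, where $A\in\mathbb R^{q\times p}$, $b\in\mathbb R^q$, $g,f_1,\dots,f_m:\mathbb R^p\to\mathbb R$ are convex, twice continuously differentiable with Lipschitz gradients, and $h=\iota_{\mathcal X}$ is the indicator function of a closed convex set $\mathcal X\subset\mathbb R^p$ ($0$ on $\mathcal X$, $+\infty$ elsewhere). $\|\cdot\|$ is the Euclidean norm (spectral norm for matrices); $[a]_+=\max(0,a)$; $\mathcal B_\gamma(v)$ is the closed ball of radius $\gamma$ centered at $v$; $|J|$ is the cardinality of $J$. A fraction with zero denominator and positive numerator is read as $+\infty$. KKT point: $w=(x,y,z)$ is a KKT point of (P) if $0\in\nabla g(x)+\partial h(x)+A^\top y+\sum_{j=1}^m z_j\nabla f_j(x)$, $Ax=b$, and $z_j\ge0$, $f_j(x)\le0$, $z_jf_j(x)=0$ for all $j$. Lipschitz/boundedness assumption: there are constants $L_g,L_1,\dots,L_m,B_1,\dots,B_m\ge 0$ such that for all $\hat x,\tilde x\in\mathcal X$ and all $j$: $\|\nabla g(\hat x)-\nabla g(\tilde x)\|\le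 L_g\|\hat x-\tilde x\|$, $\|\nabla f_j(\hat x)-\nabla f_j(\tilde x)\|\le L_j\|\hat x-\tilde x\|$, and $\|\nabla f_j(\hat x)\|\le B_j$. Nondegeneracy assumption: there are a KKT point $w^*=(x^*,y^*,z^* )$ and a subset $J\subset\{1,\dots,m\}$ such that $x^*\in\mathrm{int}(\mathcal X)$; $f_j(x^* )=0$, $z_j^*>0$ for $j\in J$ and $f_j(x^* )<0$, $z_j^*=0$ for $j\notin J$; the matrix $D=[A^\top,\nabla f_1(x^* ),\dots,\nabla f_m(x^* )]$ has full column rank; and $x^\top\big(\nabla^2g(x^* )+\sum_{j\in J}z_j^*\nabla^2f_j(x^* )\big)x>0$ for every nonzero $x\in\mathrm{Null}(D^\top)$. Augmented Lagrangian: for $\beta>0$, let $\psi_\beta(u,v)=uv+\frac\beta2u^2$ if $\beta u+v\ge0$ and $\psi_\beta(u,v)=-\frac{v^2}{2\beta}$ if $\beta u+v<0$; $\Psi_\beta(x,z)=\sum_{j=1}^m\psi_\beta(f_j(x),z_j)$; $F_\beta(x,y,z)=g(x)+y^\top(Ax-b)+\frac\beta2\|Ax-b\|^2+\Psi_\beta(x,z)$; $\mathcal L_\beta=F_\beta+h$ (so $\mathcal L_\beta=F_\beta$ for $x\in\mathrm{int}(\mathcal X)$). The constant $\mu>0$ is the smallest eigenvalue of $\nabla_x^2\mathcal L_\beta(w^* )=\nabla^2g(x^* )+\beta A^\top A+\sum_{j\in J}\big(z_j^*\nabla^2f_j(x^* )+\beta\nabla f_j(x^* )[\nabla f_j(x^*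 )]^\top\big)$, taken to be positive definite. The constant $\gamma>0$ is such that whenever $\max(\|x-x^*\|,\|y-y^*\|,\|z-z^*\|)\le\gamma$: $x\in\mathrm{int}(\mathcal X)$, $\beta f_j(x)+z_j>0$ for $j\in J$, $\beta f_j(x)+z_j<0$ for $j\notin J$, and $\nabla_x^2\mathcal L_\beta(x,y,z)\succeq\frac\mu2I$. LALM: given parameters $\beta,\rho_y,\rho_z>0$, $\delta\ge0$ and an initial point $w^0=(x^0,y^0,z^0)$, set $\eta^{-1}=0$. For $k=0,1,\dots$, let $L_F^k=L_g+\beta\|A\|^2+\sum_{j=1}^m\big(\beta B_j^2+L_j[\beta f_j(x^k)+z_j^k]_+\big)$, $\eta^k=\max(\eta^{k-1},L_F^k+\delta)$, and $$x^{k+1}=\arg\min_x\; h(x)+\langle\nabla_xF_\beta(w^k),x\rangle+\frac{\eta^k}2\|x-x^k\|^2,$$ $$y^{k+1}=y^k+\rho_y(Ax^{k+1}-b),\qquad z_j^{k+1}=z_j^k+\rho_z\max\Big(-\frac{z_j^k}\beta,f_j(x^{k+1})\Big),\ j=1,\dots,m.$$ Constants: $\underline\eta=L_g+\beta\|A\|^2+\sum_{j=1}^m\beta B_j^2$, and $\bar\eta$ is any constant satisfying $$\bar\eta\ge\delta+L_g+\beta\|A\|^2+\beta\sum_{j=1}^mB_j^2+\beta\sum_{j=1}^mB_jL_j\left(\|x^0-x^*\|+\frac{\|y^0-y^*\|}{\sqrt{\rho_y\eta^0}}+\frac{\|z^0-z^*\|}{\sqrt{\rho_z\eta^0}}\right)$$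 $$\qquad+\sqrt{\sum_{j=1}^mL_j^2}\left(\sqrt{\rho_z\bar\eta}\,\|x^0-x^*\|+\sqrt{\frac{\rho_z\bar\eta}{\rho_y\eta^0}}\,\|y^0-y^*\|+\|z^*\|+\max\Big(1,\sqrt{\frac{\bar\eta}{\eta^0}}\Big)\|z^0-z^*\|\right).$$ *)

(* Defs.v *)
From HB Require Import structures.
From mathcomp Require Import all_boot all_order all_algebra.
From mathcomp Require Import interval_inference.
From mathcomp Require Import boolp classical_sets functions reals ereal.
From mathcomp Require Import topology normedtype derive convex.

Set Implicit Arguments.
Unset Strict Implicit.
Unset Printing Implicit Defensive.

Import Order.TTheory GRing.Theory Num.Theory.
Import numFieldNormedType.Exports.

Local Open Scope classical_set_scope.
Local Open Scope ring_scope.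

Definition dotv (R : realType) (n : nat) (u v : 'cV[R]_n) : R :=
  (u^T *m v) 0 0.

(* The norm `|x| of the library on matrices is the sup norm; it induces the
   same topology and the same notion of differentiability. *)
Definition enorm (R : realType) (n : nat) (x : 'cV[R]_n) : R :=
  Num.sqrt (dotv x x).

Definition specnorm (R : realType) (m n : nat) (M : 'M[R]_(m, n)) : R :=
  sup [set enorm (M *m x) | x in [set x : 'cV[R]_n | enorm x <= 1]].

(* Meant for symmetric matrices, all of whose eigenvalues are real. *)
Definition smallest_eigenvalue (R : realType) (n : nat) (M : 'M[R]_n) (l : R) :
    Prop :=
  eigenvalue M l /\ forall l', eigenvalue M l' -> l <= l'.

Definition psd (R : realType) (n : nat) (M : 'M[R]_n) : Prop :=
  forall v : 'cV[R]_n, 0 <= dotv v (M *m v).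

Definition grad (R : realType) (n : nat) (f : 'cV[R]_n -> R) (x : 'cV[R]_n) :
    'cV[R]_n :=
  \col_i 'D_(delta_mx i 0) f x.

Definition hessian (R : realType) (n : nat) (f : 'cV[R]_n -> R)
    (x : 'cV[R]_n) : 'M[R]_n :=
  \matrix_(i, j) 'D_(delta_mx j 0) (fun u => grad f u i 0) x.

Definition twice_cont_diff (R : realType) (n : nat) (f : 'cV[R]_n -> R) :
    Prop :=
  [/\ forall x, differentiable f x,
      forall x, differentiable (grad f) x &
      continuous (hessian f)].

Definition lipschitz_grad_on (R : realType) (n : nat) (X : set 'cV[R]_n)
    (f : 'cV[R]_n -> R) (L : R) : Prop :=
  forall u v, X u -> X v -> enorm (grad f u - grad f v) <= L * enorm (u - v).

Definition indicator (R : realType) (T : Type) (X : set T) (x : T) : \bar R :=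
  if x \in X then 0%E else +oo%E.
Arguments indicator R {T} X x.

Definition subdifferential (R : realType) (n : nat) (h : 'cV[R]_n -> \bar R)
    (x : 'cV[R]_n) : set 'cV[R]_n :=
  [set v | h x \is a fin_num /\
           forall u, (h x + (dotv v (u - x))%:E <= h u)%E].

Definition is_argmin (R : realType) (T : Type) (obj : T -> \bar R) (x : T) :
    Prop :=
  forall u, (obj x <= obj u)%E.

(* min g x + h x  s.t.  A x = b and f_j x <= 0 for all j,  where h is the
   indicator function of X; p variables, q equations, m inequalities. *)
Record problem (R : realType) (p q m : nat) := Problem {
  pA : 'M[R]_(q, p);
  pb : 'cV[R]_q;
  pg : 'cV[R]_p -> R;
  pf : 'I_m -> 'cV[R]_p -> R;
  pX : set 'cV[R]_p }.

Definition ph (R : realType) (p q m : nat) (P : problem R p q m) :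
    'cV[R]_p -> \bar R :=
  indicator R (pX P).

Definition smooth_convex (R : realType) (p : nat) (f : 'cV[R]_p -> R) : Prop :=
  [/\ convex_function setT f, twice_cont_diff f &
      exists L, lipschitz_grad_on setT f L].

Definition convex_problem (R : realType) (p q m : nat) (P : problem R p q m) :
    Prop :=
  [/\ smooth_convex (pg P), forall j, smooth_convex (pf P j),
      convex_set (pX P) & closed (pX P)].

Definition kkt_point (R : realType) (p q m : nat) (P : problem R p q m)
    (x : 'cV[R]_p) (y : 'cV[R]_q) (z : 'cV[R]_m) : Prop :=
  [/\ exists2 v, subdifferential (ph P) x v &
        grad (pg P) x + v + (pA P)^T *m y
          + \sum_j z j 0 *: grad (pf P j) x = 0,
      pA P *m x = pb P &
      forall j, [/\ 0 <= z j 0, pf P j x <= 0 & z j 0 * pf P j x = 0]].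

Definition lipschitz_assumption (R : realType) (p q m : nat)
    (P : problem R p q m) (Lg : R) (L B : 'I_m -> R) : Prop :=
  [/\ 0 <= Lg, forall j, 0 <= L j /\ 0 <= B j,
      lipschitz_grad_on (pX P) (pg P) Lg,
      forall j, lipschitz_grad_on (pX P) (pf P j) (L j) &
      forall j x, pX P x -> enorm (grad (pf P j) x) <= B j].

Definition constraint_mx (R : realType) (p q m : nat) (P : problem R p q m)
    (x : 'cV[R]_p) : 'M[R]_(p, q + m) :=
  row_mx (pA P)^T (\matrix_(i, j) grad (pf P j) x i 0).

Definition nondegenerate_kkt (R : realType) (p q m : nat) (P : problem R p q m)
    (xs : 'cV[R]_p) (ys : 'cV[R]_q) (zs : 'cV[R]_m) (J : {set 'I_m}) : Prop :=
  [/\ kkt_point P xs ys zs /\ (pX P)° xs,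
      forall j, j \in J -> pf P j xs = 0 /\ 0 < zs j 0,
      forall j, j \notin J -> pf P j xs < 0 /\ zs j 0 = 0,
      \rank (constraint_mx P xs) = (q + m)%N &
      forall v : 'cV[R]_p, v != 0 -> (constraint_mx P xs)^T *m v = 0 ->
        0 < dotv v ((hessian (pg P) xs
                     + \sum_(j in J) zs j 0 *: hessian (pf P j) xs) *m v)].

Definition psi (R : realType) (beta u v : R) : R :=
  if 0 <= beta * u + v then u * v + beta / 2 * u ^+ 2
  else - (v ^+ 2 / (2 * beta)).

Definition Psi (R : realType) (p q m : nat) (P : problem R p q m) (beta : R)
    (x : 'cV[R]_p) (z : 'cV[R]_m) : R :=
  \sum_j psi beta (pf P j x) (z j 0).

Definition auglag_smooth (R : realType) (p q m : nat) (P : problem R p q m)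
    (beta : R) (x : 'cV[R]_p) (y : 'cV[R]_q) (z : 'cV[R]_m) : R :=
  pg P x + dotv y (pA P *m x - pb P)
    + beta / 2 * enorm (pA P *m x - pb P) ^+ 2 + Psi P beta x z.

Definition grad_auglag (R : realType) (p q m : nat) (P : problem R p q m)
    (beta : R) (x : 'cV[R]_p) (y : 'cV[R]_q) (z : 'cV[R]_m) : 'cV[R]_p :=
  grad (fun u => auglag_smooth P beta u y z) x.

(* The augmented Lagrangian is auglag_smooth + ph; on the interior of pX, the
   only place where its Hessian is used, it coincides with auglag_smooth. *)
Definition hess_auglag (R : realType) (p q m : nat) (P : problem R p q m)
    (beta : R) (x : 'cV[R]_p) (y : 'cV[R]_q) (z : 'cV[R]_m) : 'M[R]_p :=
  hessian (fun u => auglag_smooth P beta u y z) x.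

Definition local_radius (R : realType) (p q m : nat) (P : problem R p q m)
    (beta mu : R) (xs : 'cV[R]_p) (ys : 'cV[R]_q) (zs : 'cV[R]_m)
    (J : {set 'I_m}) (gamma : R) : Prop :=
  forall x y z,
    Num.max (enorm (x - xs)) (Num.max (enorm (y - ys)) (enorm (z - zs)))
      <= gamma ->
    [/\ (pX P)° x,
        forall j, j \in J -> 0 < beta * pf P j x + z j 0,
        forall j, j \notin J -> beta * pf P j x + z j 0 < 0 &
        psd (hess_auglag P beta x y z - (mu / 2)%:M)].

Definition lip_const (R : realType) (p q m : nat) (P : problem R p q m)
    (beta Lg : R) (L B : 'I_m -> R) (x : 'cV[R]_p) (z : 'cV[R]_m) : R :=
  Lg + beta * specnorm (pA P) ^+ 2
    + \sum_j (beta * B j ^+ 2 + L j * Num.max 0 (beta * pf P j x + z j 0)).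

Definition lalm (R : realType) (p q m : nat) (P : problem R p q m)
    (beta rho_y rho_z delta Lg : R) (L B : 'I_m -> R)
    (x : nat -> 'cV[R]_p) (y : nat -> 'cV[R]_q) (z : nat -> 'cV[R]_m)
    (eta : nat -> R) : Prop :=
  forall k,
    [/\ eta k = Num.max (if k is k'.+1 then eta k' else 0)
                        (lip_const P beta Lg L B (x k) (z k) + delta),
        is_argmin
          (fun u => (ph P u + (dotv (grad_auglag P beta (x k) (y k) (z k)) u
                               + eta k / 2 * enorm (u - x k) ^+ 2)%:E)%E)
          (x k.+1),
        y k.+1 = y k + rho_y *: (pA P *m x k.+1 - pb P) &
        forall j, z k.+1 j 0 =
          z k j 0 + rho_z * Num.max (- (z k j 0 / beta)) (pf P j (x k.+1))].

Definition eta_low (R : realType) (p q m : nat) (P : problem R p q m)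
    (beta Lg : R) (B : 'I_m -> R) : R :=
  Lg + beta * specnorm (pA P) ^+ 2 + \sum_j beta * B j ^+ 2.

Definition eta_bar_rhs (R : realType) (p q m : nat) (P : problem R p q m)
    (beta rho_y rho_z delta Lg : R) (L B : 'I_m -> R)
    (xs : 'cV[R]_p) (ys : 'cV[R]_q) (zs : 'cV[R]_m)
    (x0 : 'cV[R]_p) (y0 : 'cV[R]_q) (z0 : 'cV[R]_m) (eta0 eta_bar : R) : R :=
  delta + Lg + beta * specnorm (pA P) ^+ 2 + beta * \sum_j B j ^+ 2
  + beta * (\sum_j B j * L j)
      * (enorm (x0 - xs) + enorm (y0 - ys) / Num.sqrt (rho_y * eta0)
         + enorm (z0 - zs) / Num.sqrt (rho_z * eta0))
  + Num.sqrt (\sum_j L j ^+ 2)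
      * (Num.sqrt (rho_z * eta_bar) * enorm (x0 - xs)
         + Num.sqrt (rho_z * eta_bar / (rho_y * eta0)) * enorm (y0 - ys)
         + enorm zs
         + Num.max 1 (Num.sqrt (eta_bar / eta0)) * enorm (z0 - zs)).

Definition Cconst (R : realType) (m : nat) (beta Lg : R) (L B : 'I_m -> R)
    (J : {set 'I_m}) (zs : 'cV[R]_m) (gamma : R) : R :=
  let Lmax := \big[Num.max/0]_j L j in
  Lg ^+ 2 + 2 * #|J|%:R * (\sum_(j in J) beta ^+ 2 * B j ^+ 4
                           + 2 * Lmax ^+ 2 * (enorm zs ^+ 2 + gamma ^+ 2)).

(* Main.v *)
Require Import Defs.
From mathcomp Require Import all_boot all_order all_algebra.
From mathcomp Require Import boolp classical_sets functions reals ereal.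
From mathcomp Require Import topology normedtype derive convex.
From mathcomp Require Import interval_inference realfun ring lra.

Set Implicit Arguments.
Unset Strict Implicit.
Unset Printing Implicit Defensive.

Import Order.TTheory GRing.Theory Num.Theory.
Import numFieldNormedType.Exports.

Local Open Scope classical_set_scope.
Local Open Scope ring_scope.

(** With rho = beta / 2, one step combines three estimates.  The descent lemma
    and the optimality of x' = x^{k+1} bound F(x', w^k) - F(xs, w^k) by the
    decrease of eta^k / 2 |x - xs|^2, with beta / 2 |A x^k - b|^2 and
    delta / 2 |x' - x^k|^2 to spare.  The multiplier update bounds the same
    difference below by 1 / beta times the change of the squared dual distance.
    Together they give Fejer monotonicity, which keeps all iterates in the ball
    of radius gamma and eta^k below eta_bar.  In that ball the active set is J;
    half of the strong convexity of F at (ys, zs) yields mu / 8 |x' - xs|^2, and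
    since x' is interior its stationarity equation bounds
    nu (|y^k - ys|^2 + |z^k - zs|_J^2) by four times the spare terms and
    C |x^k - xs|^2, up to constants absorbed by the choice of alpha.  Off J the
    multipliers are halved, and eta^k increases by at most mu / 8 per step. *)

(** The value rho = beta / 2 sets the balance. With dual distances weighted by 1 / (2 rho) = 1 / b,
    a multiplier step spends rho / 2 = b / 4 of the coefficient b / 2 of |A x' - b|^2 and of
    f_j(x')^2, j in J; b / 4 remains. The difference F(x', ys, zs) - F(xs, ys, zs) is a nonnegative
    Lagrangian gap plus b / 2 times the same squares, so half of it is covered by the gap plus what
    remains. The obstacle is circular: eta^k depends on the iterates, and their bound involves
    earlier values of eta. The self-referential inequality on eta_bar closes the induction. As eta^k
    may grow, the invariant is eta^(k-1) |x^k - xs|^2 + (2 / b) D_k <= eta^(k-1) W0 (with eta^0 at k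
    = 0), where D_k is the squared dual distance and W0 depends on the start only. It implies |x^k -
    xs|^2 <= W0, so raising the weight preserves it. Of the gained mu / 8, one half pays for the
    growth of eta / 2 and the other half is the mu / 16 in phi. *)

Section EuclideanSpace.
Variable R : realType.
Implicit Types n m : nat.

(** * Inner products, Cauchy-Schwarz inequalities and the Rayleigh bound *)

Lemma dotvE n (u v : 'cV[R]_n) : dotv u v = \sum_i u i 0 * v i 0.
Proof. by rewrite /dotv mxE; apply: eq_bigr => i _; rewrite mxE. Qed.

Lemma dotvC n (u v : 'cV[R]_n) : dotv u v = dotv v u.
Proof. by rewrite !dotvE; apply: eq_bigr => i _; rewrite mulrC. Qed.

Lemma dotvDr n (u v w : 'cV[R]_n) : dotv u (v + w) = dotv u v + dotv u w.
Proof. by rewrite /dotv mulmxDr mxE. Qed.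

Lemma dotvDl n (u v w : 'cV[R]_n) : dotv (u + v) w = dotv u w + dotv v w.
Proof. by rewrite dotvC dotvDr !(dotvC w). Qed.

Lemma dotvZr n a (u v : 'cV[R]_n) : dotv u (a *: v) = a * dotv u v.
Proof. by rewrite /dotv -scalemxAr mxE. Qed.

Lemma dotvZl n a (u v : 'cV[R]_n) : dotv (a *: u) v = a * dotv u v.
Proof. by rewrite dotvC dotvZr dotvC. Qed.

Lemma dotvNr n (u v : 'cV[R]_n) : dotv u (- v) = - dotv u v.
Proof. by rewrite -scaleN1r dotvZr mulN1r. Qed.

Lemma dotvNl n (u v : 'cV[R]_n) : dotv (- u) v = - dotv u v.
Proof. by rewrite dotvC dotvNr dotvC. Qed.

Lemma dotv0r n (u : 'cV[R]_n) : dotv u 0 = 0.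
Proof. by rewrite /dotv mulmx0 mxE. Qed.

Lemma dotv0l n (u : 'cV[R]_n) : dotv 0 u = 0.
Proof. by rewrite dotvC dotv0r. Qed.

Lemma dotvBr n (u v w : 'cV[R]_n) : dotv u (v - w) = dotv u v - dotv u w.
Proof. by rewrite dotvDr dotvNr. Qed.

Lemma dotvBl n (u v w : 'cV[R]_n) : dotv (u - v) w = dotv u w - dotv v w.
Proof. by rewrite dotvDl dotvNl. Qed.

Definition dotvlin := (dotvDr, dotvDl, dotvNr, dotvNl, dotvZr, dotvZl).

Lemma dotv_suml n (I : finType) (Q : pred I) (F : I -> 'cV[R]_n) u :
  dotv (\sum_(i | Q i) F i) u = \sum_(i | Q i) dotv (F i) u.
Proof.
apply: (big_morph (fun v => dotv v u)) => [v w|]; first exact: dotvDl.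
exact: dotv0l.
Qed.

Lemma dotv_mull n m (M : 'M[R]_(n, m)) u v :
  dotv (M *m u) v = dotv u (M^T *m v).
Proof. by rewrite /dotv trmx_mul mulmxA. Qed.

Lemma dotv_ge0 n (u : 'cV[R]_n) : 0 <= dotv u u.
Proof. by rewrite dotvE sumr_ge0// => i _; rewrite -expr2 sqr_ge0. Qed.

Lemma dotv_eq0 n (u : 'cV[R]_n) : dotv u u = 0 -> u = 0.
Proof.
rewrite dotvE => /eqP; rewrite psumr_eq0; last first.
  by move=> i _; rewrite -expr2 sqr_ge0.
move=> /allP h; apply/colP => i; rewrite mxE; apply/eqP.
by have := h i (mem_index_enum _); rewrite -expr2 sqrf_eq0.
Qed.

Lemma enorm_ge0 n (u : 'cV[R]_n) : 0 <= enorm u.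
Proof. exact: sqrtr_ge0. Qed.

Lemma enorm_sq n (u : 'cV[R]_n) : enorm u ^+ 2 = dotv u u.
Proof. by rewrite sqr_sqrtr // dotv_ge0. Qed.

Lemma enorm_eq0 n (u : 'cV[R]_n) : enorm u = 0 -> u = 0.
Proof. by move=> h; apply: dotv_eq0; rewrite -enorm_sq h expr0n. Qed.

Lemma enorm0 n : enorm (0 : 'cV[R]_n) = 0.
Proof. by rewrite /enorm dotv0r sqrtr0. Qed.

Lemma enormZ n a (u : 'cV[R]_n) : enorm (a *: u) = `|a| * enorm u.
Proof.
by rewrite /enorm dotvZl dotvZr mulrA -expr2 sqrtrM ?sqr_ge0// sqrtr_sqr.
Qed.

Lemma enormN n (u : 'cV[R]_n) : enorm (- u) = enorm u.
Proof. by rewrite /enorm dotvNl dotvNr opprK. Qed.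

Lemma enormB n (u v : 'cV[R]_n) : enorm (u - v) = enorm (v - u).
Proof. by rewrite -enormN opprB. Qed.

(** The discriminant argument, for any [b] whose polynomial in t is nonnegative: it serves the dot
    product, finite sums and the semidefinite form of the Rayleigh bound. *)
Lemma form_cauchy_schwarz (T : Type) (b : T -> T -> R) (u v : T) :
  (forall t, 0 <= b u u + 2 * t * b u v + t ^+ 2 * b v v) ->
  0 <= b v v -> b u v ^+ 2 <= b u u * b v v.
Proof.
move=> h; rewrite le_eqVlt => /predU1P[v0|v0].
  rewrite -v0 mulr0; have [->|nz] := eqVneq (b u v) 0; first by rewrite expr0n.
  (* With [b v v = 0] the polynomial is affine in t, and this t makes it equal to -1. *)
  have := h (- (b u u + 1) / (2 * b u v)); rewrite -v0 mulr0 addr0.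
  suff -> : b u u + 2 * (- (b u u + 1) / (2 * b u v)) * b u v = -1 by lra.
  by field.
have := h (- b u v / b v v).
have -> : b u u + 2 * (- b u v / b v v) * b u v
    + (- b u v / b v v) ^+ 2 * b v v = b u u - b u v ^+ 2 / b v v.
  by field; rewrite gt_eqF.
by rewrite subr_ge0 ler_pdivrMr.
Qed.

Lemma dotv_cauchy_sq n (u v : 'cV[R]_n) : dotv u v ^+ 2 <= dotv u u * dotv v v.
Proof.
apply: (@form_cauchy_schwarz _ (@dotv R n)) (dotv_ge0 v) => t.
have := dotv_ge0 (u + t *: v); rewrite !dotvlin (dotvC v u).
by congr (_ <= _); ring.
Qed.

Lemma dotv_le n (u v : 'cV[R]_n) : dotv u v <= enorm u * enorm v.
Proof.
apply: (le_trans (ler_norm _)); rewrite -sqrtr_sqr /enorm -sqrtrM ?dotv_ge0//.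
by rewrite ler_wsqrtr// dotv_cauchy_sq.
Qed.

Lemma enorm_leP n (u : 'cV[R]_n) c : 0 <= c -> (enorm u <= c) = (dotv u u <= c ^+ 2).
Proof. by move=> c0; rewrite -enorm_sq ler_sqr// nnegrE ?enorm_ge0. Qed.

Lemma enormD n (u v : 'cV[R]_n) : enorm (u + v) <= enorm u + enorm v.
Proof.
rewrite enorm_leP ?addr_ge0 ?enorm_ge0// !dotvlin sqrrD !enorm_sq (dotvC v u).
have := dotv_le u v; lra.
Qed.

Lemma dotv_young n (u v : 'cV[R]_n) :
  dotv (u + v) (u + v) <= 2 * dotv u u + 2 * dotv v v.
Proof.
have := dotv_ge0 (u - v); rewrite !dotvlin (dotvC v u); lra.
Qed.

Lemma sum_cauchy (I : finType) (Q : pred I) (a b : I -> R) :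
  (\sum_(i | Q i) a i * b i) ^+ 2 <=
  (\sum_(i | Q i) a i ^+ 2) * (\sum_(i | Q i) b i ^+ 2).
Proof.
set bf := fun u v : I -> R => \sum_(i | Q i) u i * v i.
have sq u : bf u u = \sum_(i | Q i) u i ^+ 2.
  by apply: eq_bigr => i _; rewrite expr2.
have q0 u : 0 <= bf u u by rewrite sq sumr_ge0 // => i _; exact: sqr_ge0.
rewrite -!sq -/(bf a b).
apply: form_cauchy_schwarz (q0 b) => t.
have := q0 (fun i => a i + t * b i).
suff -> : bf (fun i => a i + t * b i) (fun i => a i + t * b i) =
  bf a a + 2 * t * bf a b + t ^+ 2 * bf b b by [].
rewrite /bf !mulr_sumr -!big_split /=; apply: eq_bigr => i _; ring.
Qed.

(** Cauchy-Schwarz against the constant 1 in each coordinate; the factor |J| of [Cconst] originates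
    here. *)
Lemma dotv_sum_le n (I : finType) (J : {set I}) (F : I -> 'cV[R]_n) :
  dotv (\sum_(i in J) F i) (\sum_(i in J) F i) <=
  #|J|%:R * \sum_(i in J) dotv (F i) (F i).
Proof.
have -> : \sum_(i in J) dotv (F i) (F i) =
    \sum_k \sum_(i in J) F i k 0 ^+ 2.
  rewrite exchange_big /=; apply: eq_bigr => i _; rewrite dotvE.
  by apply: eq_bigr => k _; rewrite expr2.
rewrite dotvE mulr_sumr; apply: ler_sum => k _; rewrite -expr2 summxE.
have := sum_cauchy (mem J) (fun=> 1) (fun i => F i k 0).
rewrite (eq_bigr (fun i => F i k 0)) => [|i _]; last by rewrite mul1r.
move=> /le_trans; apply; rewrite expr1n sumr_const; exact: lexx.
Qed.

(** The Frobenius norm serves as K. Only finiteness matters: it makes the supremum in [specnorm] and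
    the infimum of the Rayleigh quotient meaningful. *)
Lemma enorm_mul_bounded n m (M : 'M[R]_(m, n)) :
  exists2 K, 0 <= K & forall u, enorm (M *m u) <= K * enorm u.
Proof.
exists (Num.sqrt (\sum_i \sum_j M i j ^+ 2)); first exact: sqrtr_ge0.
move=> u; rewrite enorm_leP ?mulr_ge0 ?sqrtr_ge0// exprMn enorm_sq sqr_sqrtr.
  rewrite dotvE mulr_suml; apply: ler_sum => i _.
  rewrite -expr2 mxE (le_trans (sum_cauchy _ _ _))// dotvE ler_wpM2l//.
    by rewrite sumr_ge0// => j _; exact: sqr_ge0.
by apply: sumr_ge0 => i _; apply: sumr_ge0 => j _; exact: sqr_ge0.
Qed.

Lemma has_sup_specnorm n m (M : 'M[R]_(m, n)) :
  has_sup [set enorm (M *m x) | x in [set x : 'cV[R]_n | enorm x <= 1]].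
Proof.
split; first by exists (enorm (M *m 0)), 0 => //=; rewrite enorm0 ler01.
have [K K0 hK] := enorm_mul_bounded M.
by exists K => _ [u /= u1 <-]; rewrite (le_trans (hK u))// ler_piMr.
Qed.

Lemma specnorm_ge0 n m (M : 'M[R]_(m, n)) : 0 <= specnorm M.
Proof.
apply: (le_trans (enorm_ge0 (M *m 0))); apply: sup_upper_bound.
  exact: has_sup_specnorm.
by exists 0 => //=; rewrite enorm0 ler01.
Qed.

Lemma enorm_mul n m (M : 'M[R]_(m, n)) u :
  enorm (M *m u) <= specnorm M * enorm u.
Proof.
have [u0|u0] := eqVneq (enorm u) 0.
  by rewrite (enorm_eq0 u0) mulmx0 !enorm0 mulr0.
have up : 0 < enorm u by rewrite lt_def u0 enorm_ge0.
rewrite -ler_pdivrMr//.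
have -> : enorm (M *m u) / enorm u = enorm (M *m ((enorm u)^-1 *: u)).
  by rewrite -scalemxAr enormZ ger0_norm ?invr_ge0 ?enorm_ge0// mulrC.
apply: sup_upper_bound; first exact: has_sup_specnorm.
exists ((enorm u)^-1 *: u) => //=.
by rewrite enormZ ger0_norm ?invr_ge0 ?enorm_ge0// mulVf.
Qed.

(** From |M^T u|^2 = <M M^T u, u> <= [specnorm M] |M^T u| |u|, cancel one factor. *)
Lemma enorm_mul_tr n m (M : 'M[R]_(m, n)) u :
  enorm (M^T *m u) <= specnorm M * enorm u.
Proof.
have [u0|u0] := eqVneq (enorm (M^T *m u)) 0.
  by rewrite u0 mulr_ge0 ?specnorm_ge0 ?enorm_ge0.
have up : 0 < enorm (M^T *m u) by rewrite lt_def u0 enorm_ge0.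
rewrite -(ler_pM2r up) -expr2 enorm_sq dotv_mull trmxK.
rewrite (le_trans (dotv_le _ _))// mulrAC mulrC.
by rewrite ler_wpM2r ?enorm_ge0 ?enorm_mul.
Qed.

(* The infimum lam of the Rayleigh quotient is an eigenvalue: otherwise
   N = M - lam is an invertible psd matrix, and Cauchy-Schwarz for the form of N
   at u and N^-1 u bounds <N u, u> below by a positive multiple of |u|^2. *)
Lemma smallest_eigenvalue_rayleigh n (M : 'M[R]_n) l :
  M^T = M -> smallest_eigenvalue M l ->
  forall u, l * dotv u u <= dotv u (M *m u).
Proof.
move=> Msym [evl minl].
have [u0 u0P] : exists u0 : 'cV[R]_n, u0 != 0.
  have /eigenvalueP[w _ wn0] := evl; exists w^T.
  by apply: contra wn0 => /eqP h; rewrite -[w]trmxK h trmx0.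
have dot_gt0 (u : 'cV[R]_n) : u != 0 -> 0 < dotv u u.
  by move=> un; rewrite lt_def dotv_ge0 andbT; apply: contra un => /eqP/dotv_eq0->.
pose S := [set dotv u (M *m u) / dotv u u | u in [set u : 'cV[R]_n | u != 0]].
have [K K0 hK] := enorm_mul_bounded M.
have Sinf : has_inf S.
  split; first by exists (dotv u0 (M *m u0) / dotv u0 u0), u0.
  exists (- K) => _ [u /= un <-]; rewrite ler_pdivlMr ?dot_gt0//.
  have := dotv_le (- u) (M *m u); rewrite dotvNl enormN.
  have := ler_wpM2l (enorm_ge0 u) (hK u); rewrite -(enorm_sq u); lra.
pose lam := inf S.
have ray u : lam * dotv u u <= dotv u (M *m u).
  have [->|un] := eqVneq u 0; first by rewrite dotv0l mulr0 dotv0l.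
  rewrite -ler_pdivlMr ?dot_gt0//; apply: inf_lbound; first exact: Sinf.2.
  by exists u.
suff ev : eigenvalue M lam.
  by move=> u; apply: le_trans (ray u); rewrite ler_wpM2r ?dotv_ge0 ?minl.
case: (boolP (eigenvalue M lam)) => // noev; exfalso; move: noev.
pose N := M - lam%:M.
have Nsym : N^T = N by rewrite /N linearB /= Msym tr_scalar_mx.
have NE u v : dotv u (N *m v) = dotv u (M *m v) - lam * dotv u v.
  by rewrite /N mulmxBl dotvBr mul_scalar_mx dotvZr.
have Npsd u : 0 <= dotv u (N *m u) by rewrite NE subr_ge0.
rewrite /eigenvalue negbK /eigenspace kermx_eq0 row_free_unit => Nu.
have [K' K'0 hK'] := enorm_mul_bounded (invmx N).
(* The factor is [K' + 1] so that it is positive even when [K'] is 0. *)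
have lower u : dotv u u <= (K' + 1) * dotv u (N *m u).
  have [->|un] := eqVneq u 0; first by rewrite dotv0l mulmx0 dotv0r mulr0.
  have up := dot_gt0 _ un.
  have h3 : dotv u u ^+ 2 <= dotv u (N *m u) * dotv (invmx N *m u) u.
    have := @form_cauchy_schwarz _ (fun v w => dotv v (N *m w)) u (invmx N *m u).
    rewrite mulKVmx//; apply=> [t|]; last first.
      by have := Npsd (invmx N *m u); rewrite mulKVmx.
    have := Npsd (u + t *: (invmx N *m u)).
    rewrite mulmxDr -scalemxAr mulKVmx// !dotvlin.
    rewrite [dotv (invmx N *m u) (N *m u)]dotvC dotv_mull Nsym mulKVmx//.
    by congr (_ <= _); ring.
  have h1 := hK' u; have h2 := dotv_le (invmx N *m u) u.
  have h4 : dotv (invmx N *m u) u <= K' * dotv u u.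
    apply: le_trans h2 _; rewrite -(enorm_sq u) expr2 mulrA.
    by rewrite ler_wpM2r ?enorm_ge0.
  have h5 := ler_wpM2l (Npsd u) h4.
  have h6 := le_trans h3 h5.
  have h7 : dotv u u <= K' * dotv u (N *m u).
    by rewrite -(ler_pM2r up); move: h6; rewrite expr2; lra.
  have := Npsd u; lra.
have K'p : 0 < K' + 1 by lra.
(* By [lower], every Rayleigh quotient exceeds lam by at least (K' + 1)^-1, which contradicts lam
   being their infimum. *)
have : lam + (K' + 1)^-1 <= lam.
  apply: lb_le_inf; first exact: Sinf.1.
  move=> _ [u /= un <-]; rewrite ler_pdivlMr ?dot_gt0//.
  have := lower u; rewrite -ler_pdivrMl// NE mulrDl; lra.
by rewrite gerDl invr_le0 leNgt K'p.
Qed.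

End EuclideanSpace.

(** * Differentiation along lines, convexity and the descent lemma *)

Section Calculus.
Variable R : realType.
Implicit Types n : nat.

(** A derivative read off from a two-sided quadratic error handles the piecewise [psi] and the
    penalty on A x - b alike. *)
Lemma is_derive_quadratic_error (f : R -> R) (u a K : R) : 0 <= K ->
  (forall h, `|f (h + u) - f u - h * a| <= K * h ^+ 2) -> is_derive u 1 f a.
Proof.
move=> K0 hf.
have lim : h^-1 *: ((f \o shift u) (h *: 1) - f u) @[h --> 0^'] --> a.
  apply/cvgrPdist_le => e e0.
  have d0 : 0 < e / (K + 1) by rewrite divr_gt0// ltr_wpDl.
  near=> h; have hn0 : h != 0 by near: h; exact: nbhs_dnbhs_neq.
  have habs : 0 < `|h| by rewrite normr_gt0.
  rewrite -(ler_pM2l habs) -normrM mulrBr.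
  rewrite /= [h *: 1]mulr1.
  have -> : h * (h^-1 *: (f (h + u) - f u)) = f (h + u) - f u.
    by rewrite -[_ *: _]/(h^-1 * _) mulrA divff// mul1r.
  rewrite distrC (le_trans (hf h))// -real_normK ?num_real// expr2 mulrCA.
  rewrite ler_wpM2l//.
  have hd : `|h| <= e / (K + 1) by near: h; exact: dnbhs0_le.
  have := hd; rewrite ler_pdivlMr ?ltr_wpDl//.
  have := normr_ge0 h; nra.
apply: DeriveDef; first by apply/cvg_ex; exists a.
exact: cvg_lim.
Unshelve. all: by end_near. Qed.

(** Replaces integration along a segment: each such estimate becomes monotonicity of an auxiliary
    function of t. *)
Lemma ler_derive_ge0 (f df : R -> R) (a b : R) : a <= b ->
  (forall t, a <= t <= b -> is_derive t 1 f (df t)) ->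
  (forall t, a <= t <= b -> 0 <= df t) -> f a <= f b.
Proof.
move=> ab hd hp.
have [||c cab e] := @MVT_segment _ f df a b ab.
- move=> x; rewrite in_itv /= => /andP[ax xb]; apply: hd; rewrite !ltW//.
- apply: derivable_within_continuous => x; rewrite in_itv /= => /hd.
  by case.
rewrite -subr_ge0 e mulr_ge0 ?subr_ge0//; apply: hp.
by move: cab; rewrite in_itv.
Qed.

Lemma is_derive_line (V W : normedModType R) (f : V -> W) (x d : V) (t : R) :
  derivable f (x + t *: d) d ->
  is_derive t 1 (fun s => f (x + s *: d)) ('D_d f (x + t *: d)).
Proof.
move=> hf; set g := fun s => f (x + s *: d).
have E : (fun h => h^-1 *: ((g \o shift t) (h *: 1) - g t)) =
    (fun h => h^-1 *: ((f \o shift (x + t *: d)) (h *: d) - f (x + t *: d))).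
  apply/funext => h; rewrite /g /=; congr (_ *: (f _ - _)).
  by rewrite [h *: 1]mulr1 scalerDl addrCA.
by apply: DeriveDef; rewrite /derivable /derive E.
Qed.

Lemma col_basis n (d : 'cV[R]_n) : d = \sum_i d i 0 *: delta_mx i 0.
Proof.
rewrite {1}(matrix_sum_delta d); apply: eq_bigr => i _.
by rewrite big_ord1.
Qed.

Lemma derive_grad n (f : 'cV[R]_n -> R) x d :
  differentiable f x -> 'D_d f x = dotv (grad f x) d.
Proof.
move=> hf; rewrite deriveE// {1}(col_basis d) linear_sum dotvE.
apply: eq_bigr => i _; rewrite linearZ mxE deriveE// mulrC.
by [].
Qed.

Lemma is_derive_line_grad n (f : 'cV[R]_n -> R) x d t :
  differentiable f (x + t *: d) ->
  is_derive t 1 (fun s => f (x + s *: d)) (dotv (grad f (x + t *: d)) d).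
Proof.
by move=> hf; rewrite -derive_grad//; exact/is_derive_line/diff_derivable.
Qed.

Lemma convex_function_line n (f : 'cV[R]_n -> R) x y t :
  convex_function setT f -> 0 <= t -> t <= 1 ->
  f (x + t *: (y - x)) <= f x + t * (f y - f x).
Proof.
move=> cf t0 t1.
have := cf (Itv01 t0 t1) y x; rewrite !inE => /(_ I I).
rewrite convRE /conv /= /unstable.onem.
rewrite (_ : _ *: y + _ = x + t *: (y - x)); first by lra.
by rewrite scalerBl scale1r scalerBr addrCA.
Qed.

(** If the inequality failed by a gap e, difference quotients within e of the derivative would
    exceed f y - f x, whereas convexity bounds all of them by f y - f x. *)
Lemma convex_grad_le n (f : 'cV[R]_n -> R) x y :
  convex_function setT f -> differentiable f x ->
  f x + dotv (grad f x) (y - x) <= f y.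
Proof.
move=> cf df; rewrite leNgt; apply/negP => hlt.
have df0 : differentiable f (x + 0 *: (y - x)) by rewrite scale0r addr0.
have [+ D] := is_derive_line_grad df0.
rewrite /derivable => /cvg_ex[l hl].
move: D; rewrite /derive (cvg_lim _ hl)// scale0r addr0 => le.
rewrite {}le in hl.
pose e := f x + dotv (grad f x) (y - x) - f y.
have e0 : 0 < e by rewrite subr_gt0.
move/cvgrPdist_lt : hl => /(_ _ e0); rewrite /dnbhs /within /=.
move=> /nbhs_ballP[r /= r0 hr].
(* [r / 2] keeps h where the quotient is e-close to its limit; 1 keeps the point on the segment from
   x to y. *)
pose h := Num.min (r / 2) 1.
have h0 : 0 < h by rewrite lt_min ltr01 divr_gt0.
have h1 : h <= 1 by rewrite ge_min lexx orbT.
have hr2 : h < r.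
  by rewrite gt_min; apply/orP; left; rewrite ltr_pdivrMr// mulr2n mulrDr; lra.
have := hr h; rewrite /ball /= sub0r normrN gtr0_norm// => /(_ hr2).
rewrite gt_eqF// => /(_ isT).
have cl := @convex_function_line n f x y h cf (ltW h0) h1.
rewrite [h *: 1]mulr1 addr0 scale0r addr0 => /ltr_normlW.
rewrite -[h^-1 *: _]/(h^-1 * _).
have : h^-1 * (f (x + h *: (y - x)) - f x) <= f y - f x.
  by rewrite ler_pdivrMl//; lra.
rewrite /e; lra.
Qed.

Lemma convex_set_line n (X : set 'cV[R]_n) x y t :
  convex_set X -> X x -> X y -> 0 <= t -> t <= 1 -> X (x + t *: (y - x)).
Proof.
move=> cX Xx Xy t0 t1.
have := cX y x (Itv01 t0 t1); rewrite !inE => /(_ Xy Xx).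
rewrite /conv /= /unstable.onem.
rewrite (_ : _ *: y + _ = x + t *: (y - x))//.
by rewrite scalerBl scale1r scalerBr addrCA.
Qed.

(** Up to a constant, F is the quadratic majorant minus f along the segment, and it is
    nondecreasing. Convexity of X keeps the segment where the Lipschitz bound holds. *)
Lemma descent_lemma n (X : set 'cV[R]_n) (f : 'cV[R]_n -> R) L x y :
  convex_set X -> (forall u, differentiable f u) -> lipschitz_grad_on X f L ->
  X x -> X y ->
  f y <= f x + dotv (grad f x) (y - x) + L / 2 * dotv (y - x) (y - x).
Proof.
move=> cX df lf Xx Xy; set d := y - x.
pose F t := t * dotv (grad f x) d + (t ^+ 2 * (L / 2 * dotv d d) - f (x + t *: d)).
suff : F 0 <= F 1.
  rewrite /F scale0r scale1r addr0 (_ : x + d = y) /d; last by rewrite addrC subrK.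
  by rewrite -/d; lra.
apply: (@ler_derive_ge0 F (fun t => dotv (grad f x) d +
   (2 * t * (L / 2 * dotv d d) - dotv (grad f (x + t *: d)) d)) 0 1 ler01) => t /andP[t0 t1].
  have h1 := is_derive_line_grad (df (x + t *: d)).
  rewrite /F; apply: is_derive_eq; rewrite /GRing.scale /= ; ring.
have := dotv_le (grad f (x + t *: d) - grad f x) d; rewrite dotvBl.
have := lf (x + t *: d) x (convex_set_line cX Xx Xy t0 t1) Xx.
rewrite (addrC x) addrK enormZ ger0_norm// => h1.
have h2 := ler_wpM2r (enorm_ge0 d) h1.
rewrite -(enorm_sq d); lra.
Qed.

Lemma grad_bound_lipschitz n (X : set 'cV[R]_n) (f : 'cV[R]_n -> R) B x y :
  convex_set X -> (forall u, differentiable f u) ->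
  (forall u, X u -> enorm (grad f u) <= B) ->
  X x -> X y -> f y - f x <= B * enorm (y - x).
Proof.
move=> cX df bf Xx Xy; set d := y - x.
pose F t := t * (B * enorm d) - f (x + t *: d).
suff : F 0 <= F 1.
  rewrite /F scale0r scale1r addr0 (_ : x + d = y) /d; last by rewrite addrC subrK.
  by rewrite -/d; lra.
apply: (@ler_derive_ge0 F (fun t => B * enorm d - dotv (grad f (x + t *: d)) d) 0 1 ler01)
  => t /andP[t0 t1].
  have h1 := is_derive_line_grad (df (x + t *: d)).
  rewrite /F; apply: is_derive_eq; rewrite /GRing.scale /=; ring.
rewrite subr_ge0 (le_trans (dotv_le _ _))// ler_wpM2r ?enorm_ge0// bf//.
exact: convex_set_line.
Qed.

End Calculus.

(** * The penalty [psi]: quadratic bounds, derivative, multiplier step *)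

Section AugmentedTerm.
Variables (R : realType) (b : R).
Hypothesis b0 : 0 < b.

(** A single formula for both branches: [psi] inherits convexity, a quadratic majorant and
    differentiability from the squared positive part. *)
Lemma psiE u v : psi b u v = (Num.max 0 (b * u + v) ^+ 2 - v ^+ 2) / (2 * b).
Proof.
have bn : b != 0 by rewrite gt_eqF.
rewrite /psi; case: ifPn => [h|]; first by rewrite max_r//; field.
by rewrite -ltNge => h; rewrite max_l ?ltW//; field.
Qed.

Lemma sq_pos_part_le (s t : R) :
  Num.max 0 t ^+ 2 <=
  Num.max 0 s ^+ 2 + 2 * Num.max 0 s * (t - s) + (t - s) ^+ 2.
Proof.
have [s0|s0] := leP 0 s; have [t0|t0] := leP 0 t; rewrite ?expr0n /= -subr_ge0.
- by rewrite le_eqVlt; apply/orP; left; apply/eqP; ring.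
- have -> : s ^+ 2 + 2 * s * (t - s) + (t - s) ^+ 2 - 0 = t ^+ 2 by ring.
  exact: sqr_ge0.
- have -> : 0 + 2 * 0 * (t - s) + (t - s) ^+ 2 - t ^+ 2 =
    (- s) ^+ 2 + 2 * (- s) * t by ring.
  by rewrite addr_ge0 ?sqr_ge0// !mulr_ge0// oppr_ge0 ltW.
- have -> : 0 + 2 * 0 * (t - s) + (t - s) ^+ 2 - 0 = (t - s) ^+ 2 by ring.
  exact: sqr_ge0.
Qed.

Lemma sq_pos_part_ge (s t : R) :
  Num.max 0 s ^+ 2 + 2 * Num.max 0 s * (t - s) <= Num.max 0 t ^+ 2.
Proof.
have [s0|s0] := leP 0 s; have [t0|t0] := leP 0 t; rewrite ?expr0n /= -subr_ge0.
- have -> : t ^+ 2 - (s ^+ 2 + 2 * s * (t - s)) = (t - s) ^+ 2 by ring.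
  exact: sqr_ge0.
- have -> : 0 - (s ^+ 2 + 2 * s * (t - s)) = s ^+ 2 + 2 * s * (- t) by ring.
  by rewrite addr_ge0 ?sqr_ge0// !mulr_ge0// oppr_ge0 ltW.
- by rewrite mulr0 mul0r addr0 subr0 sqr_ge0.
- by rewrite mulr0 mul0r addr0 subr0.
Qed.

Lemma psi_le u w v : psi b w v <=
  psi b u v + Num.max 0 (b * u + v) * (w - u) + b / 2 * (w - u) ^+ 2.
Proof.
have bn : b != 0 by rewrite gt_eqF.
have b2 : 0 < 2 * b by rewrite mulr_gt0.
rewrite !psiE; have := sq_pos_part_le (b * u + v) (b * w + v).
set p := Num.max _ _; set r := Num.max _ _; rewrite -subr_ge0 => h.
rewrite -subr_ge0; suff -> : (r ^+ 2 - v ^+ 2) / (2 * b) + r * (w - u)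
    + b / 2 * (w - u) ^+ 2 - (p ^+ 2 - v ^+ 2) / (2 * b) =
  (r ^+ 2 + 2 * r * (b * w + v - (b * u + v)) + (b * w + v - (b * u + v)) ^+ 2
    - p ^+ 2) / (2 * b) by exact: divr_ge0 h (ltW b2).
by field.
Qed.

Lemma psi_ge u w v :
  psi b u v + Num.max 0 (b * u + v) * (w - u) <= psi b w v.
Proof.
have b2 : 0 < 2 * b by rewrite mulr_gt0.
rewrite !psiE; have := sq_pos_part_ge (b * u + v) (b * w + v).
set r := Num.max _ _; set p := Num.max _ _; rewrite -subr_ge0 => h.
rewrite -subr_ge0; suff -> : (p ^+ 2 - v ^+ 2) / (2 * b) -
    ((r ^+ 2 - v ^+ 2) / (2 * b) + r * (w - u)) =
  (p ^+ 2 - (r ^+ 2 + 2 * r * (b * w + v - (b * u + v)))) / (2 * b)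
  by exact: divr_ge0 h (ltW b2).
by field; rewrite gt_eqF.
Qed.

Lemma is_derive_psi (u v : R) :
  is_derive u 1 (fun s : R => psi b s v) (Num.max 0 (b * u + v)).
Proof.
apply: (@is_derive_quadratic_error _ _ _ _ (b / 2)).
  by rewrite divr_ge0// ltW.
move=> h; have := psi_le u (h + u) v; have := psi_ge u (h + u) v.
rewrite addrK => h1 h2; rewrite ger0_norm; lra.
Qed.

(** In the branch [0 <= b * f + z] the two sides differ by b / 4 f^2. In the other one the
    multiplier is halved, and the claim reduces to zs (f + z / b) <= 0 and to -3/4 <= -1/2 in front
    of z^2 / b. *)
Lemma psi_dual_step f z zs : 0 <= zs ->
  zs * f + b^-1 * ((z + b / 2 * Num.max (- (z / b)) f - zs) ^+ 2 - (z - zs) ^+ 2)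
  <= psi b f z.
Proof.
move=> zs0; have bn : b != 0 by rewrite gt_eqF.
have bi : 0 < b^-1 by rewrite invr_gt0.
rewrite /psi; case: ifPn => h.
  rewrite max_r; last first.
    by rewrite -mulNr ler_pdivrMr// -subr_ge0 opprK (mulrC f) .
  have -> : b^-1 * ((z + b / 2 * f - zs) ^+ 2 - (z - zs) ^+ 2) =
     (z - zs) * f + b / 4 * f ^+ 2 by field.
  have : 0 <= b * f ^+ 2 by rewrite mulr_ge0 ?sqr_ge0// ltW.
  lra.
have hf : f < - (z / b).
  by rewrite -mulNr ltr_pdivlMr// -subr_lt0 opprK (mulrC f) ltNge.
rewrite max_l; last exact: ltW.
have -> : b^-1 * ((z + b / 2 * - (z / b) - zs) ^+ 2 - (z - zs) ^+ 2) =
   zs * (z / b) - 3 / 4 * (b^-1 * z ^+ 2) by field.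
have -> : z ^+ 2 / (2 * b) = (b^-1 * z ^+ 2) / 2 by field.
have := mulr_ge0 (ltW bi) (sqr_ge0 z).
have := ler_wpM2l zs0 (ltW hf).
lra.
Qed.

(** Keeps the surplus b / 4 f^2 that [psi_dual_step] discards; the strong convexity estimate
    consumes it. *)
Lemma psi_dual_step_active f z zs : 0 <= b * f + z ->
  zs * f + b / 4 * f ^+ 2
    + b^-1 * ((z + b / 2 * Num.max (- (z / b)) f - zs) ^+ 2 - (z - zs) ^+ 2)
  = psi b f z.
Proof.
move=> h; have bn : b != 0 by rewrite gt_eqF.
rewrite /psi h max_r; last first.
  by rewrite -mulNr ler_pdivrMr// -subr_ge0 opprK (mulrC f).
by field.
Qed.

Lemma psi_le0 f z : f <= 0 -> psi b f z <= 0.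
Proof.
move=> f0; have bi : 0 <= (2 * b)^-1 by rewrite invr_ge0 mulr_ge0 // ltW.
rewrite /psi; case: ifPn => h; last by rewrite oppr_le0 mulr_ge0 ?sqr_ge0.
have -> : f * z + b / 2 * f ^+ 2 = f * (b * f + z) + (b * f ^+ 2) * (- 1/2) by field.
have h1 : f * (b * f + z) <= 0 by rewrite mulr_le0_ge0.
have h2 : 0 <= b * f ^+ 2 by rewrite mulr_ge0 ?sqr_ge0// ltW.
lra.
Qed.

End AugmentedTerm.

(** * Gradient and Hessian of the augmented Lagrangian along segments *)

Section AugmentedLagrangian.
Variables (R : realType) (p q m : nat) (P : problem R p q m) (b : R).
Hypothesis b0 : 0 < b.
Hypothesis dg : forall x, differentiable (pg P) x.
Hypothesis df : forall j x, differentiable (pf P j) x.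

(** Reduces directional derivatives to one-variable ones, where the quadratic error criterion and
    the chain rule for [psi] apply. *)
Lemma is_derive_from_line n (f : 'cV[R]_n -> R) (x d : 'cV[R]_n) (a : R) :
  is_derive (0 : R) 1 (fun s : R => f (x + s *: d)) a -> is_derive x d f a.
Proof.
set g := fun s => f (x + s *: d) => -[].
have E : (fun h => h^-1 *: ((g \o shift 0) (h *: 1) - g 0)) =
    (fun h => h^-1 *: ((f \o shift x) (h *: d) - f x)).
  apply/funext => h; rewrite /g /= scale0r !addr0.
  by rewrite [h *: 1]mulr1 (addrC x).
by rewrite /derivable /derive E => h1 h2; apply: DeriveDef.
Qed.

(** Closed form of [grad_auglag], identified in [grad_auglagE]; the positive parts are the
    derivatives of [psi]. *)
Definition auggrad x (y : 'cV[R]_q) (z : 'cV[R]_m) : 'cV[R]_p :=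
  grad (pg P) x + (pA P)^T *m (y + b *: (pA P *m x - pb P))
  + \sum_j Num.max 0 (b * pf P j x + z j 0) *: grad (pf P j) x.

Lemma is_derive_auglag x y z d :
  is_derive x d (fun u => auglag_smooth P b u y z) (dotv (auggrad x y z) d).
Proof.
apply: is_derive_from_line.
set A := pA P; have [r rdef] : {r | A *m x - pb P = r} by eexists.
have rE (s : R) : A *m (x + s *: d) - pb P = r + s *: (A *m d).
  by rewrite mulmxDr -scalemxAr addrAC rdef.
have h1 : is_derive (0 : R) 1 (fun s : R => pg P (x + s *: d)) (dotv (grad (pg P) x) d).
  by have := is_derive_line_grad (dg (x + 0 *: d)); rewrite scale0r addr0.
have h2 : is_derive (0 : R) 1
    (fun s : R => dotv y (r + s *: (A *m d)) + b / 2 * enorm (r + s *: (A *m d)) ^+ 2)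
    (dotv (A^T *m (y + b *: r)) d).
  apply: (@is_derive_quadratic_error _ _ _ _ (b / 2 * dotv (A *m d) (A *m d))).
    by rewrite mulr_ge0 ?dotv_ge0// divr_ge0// ltW.
  move=> h; rewrite dotv_mull trmxK !enorm_sq addr0 scale0r addr0 !dotvlin.
  rewrite (dotvC (A *m d) r) ger0_norm; first by rewrite le_eqVlt; apply/orP; left; apply/eqP; field.
  rewrite (_ : _ - _ = h ^+ 2 * (b / 2 * dotv (A *m d) (A *m d))); last by field.
  by rewrite mulr_ge0 ?sqr_ge0// mulr_ge0 ?dotv_ge0// divr_ge0// ltW.
have h3 j : is_derive (0 : R) 1 (fun s : R => psi b (pf P j (x + s *: d)) (z j 0))
    (Num.max 0 (b * pf P j x + z j 0) * dotv (grad (pf P j) x) d).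
  have hl := is_derive_line_grad (df j (x + 0 *: d)).
  have hp := @is_derive_psi _ _ b0 (pf P j (x + 0 *: d)) (z j 0).
  by have := is_derive1_comp hp hl; rewrite scale0r addr0.
have h4 := is_deriveD (is_deriveD h1 h2) (is_derive_sum h3).
have -> : (fun s : R => auglag_smooth P b (x + s *: d) y z) =
  (fun s : R => pg P (x + s *: d)) +
  (fun s : R => dotv y (r + s *: (A *m d)) + b / 2 * enorm (r + s *: (A *m d)) ^+ 2)
  + \sum_(j < m) (fun s : R => psi b (pf P j (x + s *: d)) (z j 0)).
  apply/funext => s; rewrite /auglag_smooth -/A rE.
  by rewrite -[in RHS]/(_ + _ + _) fct_sumE /= addrA.
apply: is_derive_eq h4 _.
rewrite /auggrad -/A rdef !dotvDl dotv_suml; congr (_ + _).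
by apply: eq_bigr => j _; rewrite dotvZl.
Qed.

Lemma dotv_delta n (u : 'cV[R]_n) i : dotv u (delta_mx i 0) = u i 0.
Proof.
rewrite dotvE (bigD1 i)//= mxE !eqxx mulr1 big1 ?addr0// => j ji.
by rewrite mxE (negPf ji) mulr0.
Qed.

Lemma grad_auglagE x y z : grad_auglag P b x y z = auggrad x y z.
Proof.
apply/colP => i; rewrite mxE -[RHS]dotv_delta.
by have [] := is_derive_auglag x y z (delta_mx i 0).
Qed.

Lemma is_derive_auglag_line x y z d (t : R) :
  is_derive t 1 (fun s : R => auglag_smooth P b (x + s *: d) y z)
    (dotv (auggrad (x + t *: d) y z) d).
Proof.
have [h1 <-] := is_derive_auglag (x + t *: d) y z d.
exact: (@is_derive_line _ _ _ (fun u => auglag_smooth P b u y z)).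
Qed.

Hypothesis dgg : forall x, differentiable (grad (pg P)) x.
Hypothesis dfg : forall j x, differentiable (grad (pf P j)) x.
Variable J : {set 'I_m}.

(** [auggrad] with each positive part replaced by the value it has when J is the active set. The
    result is differentiable everywhere and agrees with [auggrad] near any point where the signs are
    strict. *)
Definition active_grad x (y : 'cV[R]_q) (z : 'cV[R]_m) : 'cV[R]_p :=
  grad (pg P) x + (pA P)^T *m (y + b *: (pA P *m x - pb P))
  + \sum_j (j \in J)%:R * (b * pf P j x + z j 0) *: grad (pf P j) x.

Lemma differentiable_entry n k (f : 'cV[R]_n -> 'cV[R]_k) x i :
  differentiable f x -> differentiable (fun u => f u i 0) x.
Proof.
move=> hf; apply: (@differentiable_comp _ _ _ _ f (fun v : 'cV[R]_k => v i 0)) => //.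
exact: differentiable_coord.
Qed.

Lemma differentiable_mulmx_entry n k (M : 'M[R]_(k, n)) x i :
  differentiable (fun u : 'cV[R]_n => (M *m u) i 0) x.
Proof.
have -> : (fun u : 'cV[R]_n => (M *m u) i 0) =
    \sum_(j < n) (M i j *: (fun u : 'cV[R]_n => u j 0)).
  by apply/funext => u; rewrite fct_sumE mxE.
apply: differentiable_sum => j; apply: differentiableZ.
exact: differentiable_coord.
Qed.

Lemma differentiable_active_grad x y z i :
  differentiable (fun u => active_grad u y z i 0) x.
Proof.
have -> : (fun u => active_grad u y z i 0) =
  (fun u => grad (pg P) u i 0) +
  (cst (((pA P)^T *m (y - b *: pb P)) i 0) +
   (fun u => ((b *: (pA P)^T *m pA P) *m u) i 0)) +
  \sum_(j < m) ((j \in J)%:R *: (b *: pf P j + cst (z j 0))) *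
     (fun u => grad (pf P j) u i 0).
  apply/funext => u; rewrite /active_grad.
  have -> : (pA P)^T *m (y + b *: (pA P *m u - pb P)) =
      (pA P)^T *m (y - b *: pb P) + (b *: (pA P)^T *m pA P) *m u.
    rewrite -mulmxA -scalemxAl scalemxAr -mulmxDr scalerBr.
    by congr (_ *m _); rewrite addrAC addrA.
  rewrite mxE [in X in X + _]mxE [X in _ + X + _]mxE summxE.
  rewrite -[in RHS]/(_ + _ + _) fct_sumE; congr (_ + _).
  by apply: eq_bigr => j _; rewrite mxE.
apply: differentiableD; first apply: differentiableD.
- exact: differentiable_entry.
- by apply: differentiableD => //; exact: differentiable_mulmx_entry.
- apply: differentiable_sum => j; apply: differentiableM.
    apply: differentiableZ; apply: differentiableD => //.
    exact: differentiableZ.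
  exact: differentiable_entry.
Qed.

Lemma near_active_grad x y (z : 'cV[R]_m) :
  (forall j, j \in J -> 0 < b * pf P j x + z j 0) ->
  (forall j, j \notin J -> b * pf P j x + z j 0 < 0) ->
  \forall u \near x, auggrad u y z = active_grad u y z.
Proof.
move=> hJ hN.
have cf j : (b * pf P j u + z j 0) @[u --> x] --> b * pf P j x + z j 0.
  have D : differentiable ((b *: pf P j) + cst (z j 0)) x.
    by apply: differentiableD => //; exact: differentiableZ.
  exact: (differentiable_continuous D).
have near_j j : \forall u \near x,
    Num.max 0 (b * pf P j u + z j 0) = (j \in J)%:R * (b * pf P j u + z j 0).
  have [jJ|jJ] := boolP (j \in J).
    apply: filterS (cvgr_gt _ (cf j) _ (hJ j jJ)) => u hu.
    by rewrite mul1r max_r// ltW.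
  apply: filterS (cvgr_lt _ (cf j) _ (hN j jJ)) => u hu.
  by rewrite mul0r max_l// ltW.
apply: filterS (filter_forall _ near_j) => u hu.
by rewrite /auggrad /active_grad; congr (_ + _); apply: eq_bigr => j _; rewrite hu.
Qed.

(** [hess_auglag] differentiates a gradient containing positive parts; near the point this gradient
    equals [active_grad], which supplies the differentiability. *)
Lemma is_derive_auggrad_line x y (z : 'cV[R]_m) d (t : R) :
  (forall j, j \in J -> 0 < b * pf P j (x + t *: d) + z j 0) ->
  (forall j, j \notin J -> b * pf P j (x + t *: d) + z j 0 < 0) ->
  is_derive t 1 (fun s : R => dotv (auggrad (x + s *: d) y z) d)
    (dotv d (hess_auglag P b (x + t *: d) y z *m d)).
Proof.
move=> hJ hN; have nr := near_active_grad y hJ hN.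
pose S i u := active_grad u y z i 0.
have dS i : differentiable (S i) (x + t *: d) by exact: differentiable_active_grad.
have h i : is_derive t 1 (fun s : R => S i (x + s *: d))
    (dotv (grad (S i) (x + t *: d)) d) by exact: is_derive_line_grad.
have := is_derive_sum (fun i => is_deriveZ (d i 0) (h i)).
have -> : \sum_(i < p) d i 0 *: dotv (grad (S i) (x + t *: d)) d =
    dotv d (hess_auglag P b (x + t *: d) y z *m d).
  rewrite [RHS]dotvE; apply: eq_bigr => i _; congr (_ * _).
  rewrite mxE dotvE; apply: eq_bigr => k _; congr (_ * _); rewrite !mxE.
  apply: near_eq_derive; apply: filterS nr => u hu.
  by rewrite -/(grad_auglag P b u y z) grad_auglagE /S hu.
apply: near_eq_is_derive.
have cl : (x + s *: d) @[s --> t] --> x + t *: d.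
  have [+ _] := is_derive_line (@derivable_id _ _ (x + t *: d) d).
  by move=> /derivable1_diffP/differentiable_continuous.
apply: (@filterS _ (nbhs t) _ _ _ _ (cl _ nr)) => s /= hs.
rewrite hs fct_sumE dotvE; apply: eq_bigr => i _.
by rewrite mulrC.
Qed.

(** Two integrations along the segment: the Hessian bound mu / 2 makes the directional derivative
    grow by t mu / 2 times |x - x0|^2, and integrating t produces mu / 4. *)
Lemma auglag_strong_convexity mu x0 x y (z : 'cV[R]_m) :
  (forall t, 0 <= t <= 1 ->
    [/\ forall j, j \in J -> 0 < b * pf P j (x0 + t *: (x - x0)) + z j 0,
        forall j, j \notin J -> b * pf P j (x0 + t *: (x - x0)) + z j 0 < 0 &
        psd (hess_auglag P b (x0 + t *: (x - x0)) y z - (mu / 2)%:M)]) ->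
  auglag_smooth P b x0 y z + dotv (auggrad x0 y z) (x - x0)
    + mu / 4 * dotv (x - x0) (x - x0) <= auglag_smooth P b x y z.
Proof.
have [d dE] : {d | x - x0 = d} by eexists.
rewrite dE => hyp.
have step t : 0 <= t <= 1 ->
    0 <= dotv (auggrad (x0 + t *: d) y z) d - dotv (auggrad x0 y z) d
         - t * (mu / 2 * dotv d d).
  move=> /andP[t0 t1].
  pose G s := dotv (auggrad (x0 + s *: d) y z) d - s * (mu / 2 * dotv d d).
  suff : G 0 <= G t.
    rewrite /G scale0r addr0; move: (dotv (auggrad (x0 + t *: d) y z) d).
    by move: (dotv (auggrad x0 y z) d) (dotv d d) => u v w; lra.
  apply: (@ler_derive_ge0 _ G (fun s => dotv d (hess_auglag P b (x0 + s *: d) y z *m d)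
      - mu / 2 * dotv d d) 0 t t0) => s /andP[s0 st].
    have [|h1 h2 _] := hyp s; first by rewrite s0 (le_trans st).
    have h3 := is_derive_auggrad_line y h1 h2.
    rewrite /G; apply: is_derive_eq; rewrite /GRing.scale /=.
    by move: (dotv d d) (dotv d _) => u v; ring.
  have [|_ _ h] := hyp s; first by rewrite s0 (le_trans st).
  by have := h d; rewrite mulmxBl mul_scalar_mx dotvBr dotvZr.
pose F s := auglag_smooth P b (x0 + s *: d) y z
   - (s * dotv (auggrad x0 y z) d + s ^+ 2 * (mu / 4 * dotv d d)).
suff : F 0 <= F 1.
  rewrite /F scale0r scale1r addr0 -dE (addrC x0) subrK dE; lra.
apply: (@ler_derive_ge0 _ F (fun s => dotv (auggrad (x0 + s *: d) y z) d -
   (dotv (auggrad x0 y z) d + 2 * s * (mu / 4 * dotv d d))) 0 1 ler01) => s s01.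
  have h3 := is_derive_auglag_line x0 y z d s.
  rewrite /F; apply: is_derive_eq; rewrite /GRing.scale /=.
  by move: (dotv (auggrad x0 y z) d) (dotv d d) (dotv _ d) => u v w; ring.
have := step s s01; move: (dotv (auggrad (x0 + s *: d) y z) d).
by move: (dotv (auggrad x0 y z) d) (dotv d d) => u v w; lra.
Qed.

End AugmentedLagrangian.

(** * First-order conditions of the proximal step *)

Section ProximalStep.
Variable R : realType.

(** The normal cone at an interior point is trivial: x + s v stays in X for small s > 0, and testing
    with it gives s |v|^2 <= 0. *)
Lemma interior_normal0 n (X : set 'cV[R]_n) x v :
  X° x -> (forall u, X u -> dotv v (u - x) <= 0) -> v = 0.
Proof.
move=> iX hv; apply: dotv_eq0; apply/eqP; rewrite eq_le dotv_ge0 andbT.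
have cl : (x + s *: v) @[s --> (0 : R)] --> x + 0 *: v.
  have [+ _] := is_derive_line (@derivable_id _ _ (x + (0 : R) *: v) v).
  by move=> /derivable1_diffP/differentiable_continuous.
rewrite scale0r addr0 in cl.
have : nbhs (0 : R) (fun s => X (x + s *: v)) by exact: (cl _ iX).
move=> /nbhs_ballP[r /= r0 hr].
have r2 : 0 < r / 2 by rewrite divr_gt0.
have := hr (r / 2); rewrite /ball /= sub0r normrN gtr0_norm//.
rewrite ltr_pdivrMr// mulr_natr mulr2n ltrDl => /(_ r0)/hv.
by rewrite addrC addKr dotvZr pmulr_rle0.
Qed.

Lemma argmin_indicator n (X : set 'cV[R]_n) (G xk x' x0 : 'cV[R]_n) (e : R) :
  convex_set X -> 0 <= e -> X x0 ->
  is_argmin (fun u => (indicator R X u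
    + (dotv G u + e / 2 * enorm (u - xk) ^+ 2)%:E)%E) x' ->
  X x' /\ forall u, X u -> 0 <= dotv (G + e *: (x' - xk)) (u - x').
Proof.
move=> cX e0 Xx0 am.
have indX u : X u -> indicator R X u = 0%E by move=> Xu; rewrite /indicator mem_set.
have Xx' : X x'.
  apply: contrapT => nX; have := am x0.
  rewrite (indX _ Xx0) /indicator (memNset nX) add0e.
  by rewrite addye// leye_eq.
split=> // u Xu; rewrite leNgt; apply/negP.
have [d dE] : {d | u - x' = d} by eexists.
have [s sE] : {s | x' - xk = s} by eexists.
rewrite dE sE; set c := dotv _ _ => c0.
have key t : 0 <= t -> t <= 1 -> 0 <= t * c + t ^+ 2 * (e / 2 * dotv d d).
  move=> t0 t1; have := am (x' + t *: (u - x')).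
  rewrite (indX _ Xx') indX; last exact: convex_set_line.
  rewrite !add0e lee_fin dE (addrAC _ _ (- xk)) sE !enorm_sq.
  by rewrite /c !dotvlin (dotvC d s) -subr_ge0; congr (_ <= _); field.
have n0 : 0 <= e * dotv d d by rewrite mulr_ge0 ?dotv_ge0.
(* This t keeps the quadratic contribution t e |d|^2 / 2 below -c / 2, too small to offset c < 0. *)
pose t := Num.min 1 (- c / (e * dotv d d + 1)).
have p1 : 0 < e * dotv d d + 1 by lra.
have t0 : 0 < t by rewrite lt_min ltr01 divr_gt0// oppr_gt0.
have t1 : t <= 1 by rewrite ge_min lexx.
have tc : t * (e * dotv d d + 1) <= - c.
  by rewrite -ler_pdivlMr// ge_min lexx orbT.
have := key t (ltW t0) t1.
have -> : t * c + t ^+ 2 * (e / 2 * dotv d d) = t * (c + t * (e * dotv d d) / 2).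
  by field.
rewrite pmulr_rge0//; have := mulr_ge0 (ltW t0) n0; lra.
Qed.

End ProximalStep.

(** * Descent, convexity and decrease for one primal step *)

Section OneStep.
Variables (R : realType) (p q m : nat) (P : problem R p q m) (b Lg : R).
Variables (L B : 'I_m -> R).
Hypothesis b0 : 0 < b.
Hypothesis cP : convex_problem P.
Hypothesis lP : lipschitz_assumption P Lg L B.

Lemma problem_regularity :
  [/\ forall x, differentiable (pg P) x, forall j x, differentiable (pf P j) x,
      forall x, differentiable (grad (pg P)) x &
      forall j x, differentiable (grad (pf P j)) x].
Proof.
have [[_ [h1 h2 _] _] hf _ _] := cP.
by split=> // j; have [_ [h3 h4 _] _] := hf j.
Qed.

Lemma lip_const_ge0 x z : 0 <= lip_const P b Lg L B x z.
Proof.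
have [Lg0 LB _ _ _] := lP.
have h1 : 0 <= b * specnorm (pA P) ^+ 2 by rewrite mulr_ge0 ?sqr_ge0 ?(ltW b0).
apply: addr_ge0; first exact: addr_ge0.
apply: sumr_ge0 => j _; have [L0 B0] := LB j.
apply: addr_ge0; first by rewrite mulr_ge0 ?sqr_ge0 ?(ltW b0).
by rewrite mulr_ge0// le_max lexx.
Qed.

Lemma sq_le_of_lipschitz (a c : R) : a <= c -> - a <= c -> a ^+ 2 <= c ^+ 2.
Proof.
move=> h1 h2; have c0 : 0 <= c by lra.
by rewrite -[a ^+ 2]real_normK ?num_real// ler_sqr ?nnegrE// ler_norml; lra.
Qed.

(** Explains the form of [lip_const]: the descent lemma for f_j enters with the nonnegative weight
    max(0, b f_j(x) + z_j) taken at the base point, and the remainder b / 2 (f_j(x') - f_j(x))^2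
    costs b B_j^2 / 2 |x' - x|^2. *)
Lemma auglag_descent x x' y z : pX P x -> pX P x' ->
  auglag_smooth P b x' y z <= auglag_smooth P b x y z
    + dotv (auggrad P b x y z) (x' - x)
    + lip_const P b Lg L B x z / 2 * dotv (x' - x) (x' - x).
Proof.
move=> Xx Xx'; have [dg df _ _] := problem_regularity.
have [_ _ cX _] := cP; have [Lg0 LB lg lf bf] := lP.
have Hg := descent_lemma cX dg lg Xx Xx'.
have [d dE] : {d | x' - x = d} by eexists.
have [r rE] : {r | pA P *m x - pb P = r} by eexists.
have r'E : pA P *m x' - pb P = r + pA P *m d.
  by rewrite -dE -rE mulmxBr addrAC addrCA subrr addr0.
have Hf j : psi b (pf P j x') (z j 0) <= psi b (pf P j x) (z j 0)
    + Num.max 0 (b * pf P j x + z j 0) * dotv (grad (pf P j) x) d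
    + (b * B j ^+ 2 + L j * Num.max 0 (b * pf P j x + z j 0)) / 2 * dotv d d.
  apply: (le_trans (psi_le b0 (pf P j x) (pf P j x') (z j 0))).
  have := descent_lemma cX (df j) (lf j) Xx Xx'.
  have := grad_bound_lipschitz cX (df j) (bf j) Xx Xx'.
  have := grad_bound_lipschitz cX (df j) (bf j) Xx' Xx.
  rewrite (enormB x) dE; set M := Num.max _ _ => h1 h2 h3.
  have M0 : 0 <= M by rewrite le_max lexx.
  have h4 : (pf P j x' - pf P j x) ^+ 2 <= B j ^+ 2 * dotv d d.
    by rewrite -enorm_sq -exprMn sq_le_of_lipschitz// opprB.
  have h5 : M * (pf P j x' - pf P j x) <=
      M * (dotv (grad (pf P j) x) d + L j / 2 * dotv d d).
    by rewrite ler_wpM2l// lerBlDl addrA.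
  have h6 := ler_wpM2l (ltW b0) h4.
  move: h5 h6; rewrite [(b * _ + _) / 2 * _](_ : _ = (b * (B j ^+ 2 * dotv d d)
    + M * (L j * dotv d d)) / 2); last by field.
  move: (psi _ _ _) (M * (_ - _)) (_ ^+ 2) (B j ^+ 2 * _) => p0 u v w.
  rewrite mulrDr; lra.
have Hs := ler_sum (index_enum 'I_m) (fun j (_ : xpredT j) => Hf j).
have HA : b * dotv (pA P *m d) (pA P *m d) <= b * specnorm (pA P) ^+ 2 * dotv d d.
  rewrite -mulrA ler_wpM2l ?(ltW b0)//.
  rewrite -[dotv d d]enorm_sq -exprMn -enorm_leP ?enorm_mul//.
  by rewrite mulr_ge0 ?specnorm_ge0 ?enorm_ge0.
rewrite dE in Hg *.
rewrite /auglag_smooth /Psi /lip_const /auggrad r'E rE.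
move: Hs; rewrite !big_split /= -!mulr_suml big_split /= => Hs.
rewrite !enorm_sq !dotvDl dotv_suml.
under [X in _ <= _ + (_ + X) + _]eq_bigr do rewrite dotvZl.
rewrite [dotv ((pA P)^T *m _) d]dotv_mull trmxK !dotvDr !dotvDl !dotvZl (dotvC (_ *m d) r).
lra.
Qed.

(** The quadratic term of A is retained because for feasible u it equals the spare b / 2 |A x - b|^2
    needed by the dual error bound. *)
Lemma auglag_convex x u y z :
  auglag_smooth P b x y z + dotv (auggrad P b x y z) (u - x)
    + b / 2 * dotv (pA P *m (u - x)) (pA P *m (u - x))
  <= auglag_smooth P b u y z.
Proof.
have [dg df _ _] := problem_regularity.
have [[cg _ _] cf _ _] := cP.
have Hg := convex_grad_le u cg (dg x).
have [d dE] : {d | u - x = d} by eexists.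
have [r rE] : {r | pA P *m x - pb P = r} by eexists.
have r'E : pA P *m u - pb P = r + pA P *m d.
  by rewrite -dE -rE mulmxBr addrAC addrCA subrr addr0.
have Hf j : psi b (pf P j x) (z j 0)
    + Num.max 0 (b * pf P j x + z j 0) * dotv (grad (pf P j) x) d
    <= psi b (pf P j u) (z j 0).
  apply: le_trans (psi_ge b0 (pf P j x) (pf P j u) (z j 0)).
  have [cfj _ _] := cf j; have := convex_grad_le u cfj (df j x).
  rewrite dE => h; rewrite lerD2l ler_wpM2l ?le_max ?lexx//; lra.
have Hs := ler_sum (index_enum 'I_m) (fun j (_ : xpredT j) => Hf j).
rewrite dE in Hg *.
rewrite /auglag_smooth /Psi /auggrad r'E rE.
move: Hs; rewrite !big_split /= => Hs.
rewrite !enorm_sq !dotvDl dotv_suml.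
under [X in _ + (_ + X) + _ <= _]eq_bigr do rewrite dotvZl.
rewrite [dotv ((pA P)^T *m _) d]dotv_mull trmxK !dotvDr !dotvDl !dotvZl (dotvC (_ *m d) r).
lra.
Qed.

(** Descent from x to x' and convexity from x to xs leave <grad F(x), x' - xs>. The variational
    inequality and the three-point identity turn it into a difference of squared distances, with e /
    2 |x' - x|^2 gained against the descent loss. *)
Lemma prox_step_decrease x x' xs y z e :
  pX P x -> pX P x' -> pA P *m xs = pb P ->
  0 <= dotv (auggrad P b x y z + e *: (x' - x)) (xs - x') ->
  auglag_smooth P b x' y z - auglag_smooth P b xs y z
    + b / 2 * dotv (pA P *m x - pb P) (pA P *m x - pb P)
    + (e - lip_const P b Lg L B x z) / 2 * dotv (x' - x) (x' - x)
  <= e / 2 * (dotv (x - xs) (x - xs) - dotv (x' - xs) (x' - xs)).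
Proof.
move=> Xx Xx' Axs vi.
have h1 := auglag_descent y z Xx Xx'.
have h2 := auglag_convex x xs y z.
have rE : pA P *m (xs - x) = - (pA P *m x - pb P) by rewrite mulmxBr Axs opprB.
move: h2; rewrite rE dotvNl dotvNr opprK => h2.
have [d dE] : {d | x' - x = d} by eexists.
have [w wE] : {w | x' - xs = w} by eexists.
have e1 : xs - x' = - w by rewrite -wE opprB.
have e2 : xs - x = d - w by rewrite -wE -dE opprB [RHS]addrC addrA subrK.
have e3 : x - xs = w - d by rewrite -(opprB xs) e2 opprB.
rewrite ?dE ?wE ?e1 ?e2 ?e3 in h1 h2 vi *.
move: h1 h2 vi; rewrite !dotvlin (dotvC d w).
move: (auglag_smooth P b x y z) (auglag_smooth P b x' y z) (auglag_smooth P b xs y z).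
move: (lip_const P b Lg L B x z) (dotv (auggrad P b x y z) d) (dotv (auggrad P b x y z) w).
move=> l g1 g2 F1 F2 F3.
lra.
Qed.

End OneStep.

(** * Estimates around the KKT point *)

Section KKT.
Variables (R : realType) (p q m : nat) (P : problem R p q m) (b Lg : R).
Variables (L B : 'I_m -> R).
Variables (xs : 'cV[R]_p) (ys : 'cV[R]_q) (zs : 'cV[R]_m) (J : {set 'I_m}).
Hypothesis b0 : 0 < b.
Hypothesis cP : convex_problem P.
Hypothesis lP : lipschitz_assumption P Lg L B.
Hypothesis nd : nondegenerate_kkt P xs ys zs J.

Lemma kkt_interior_stationary :
  grad (pg P) xs + (pA P)^T *m ys + \sum_j zs j 0 *: grad (pf P j) xs = 0.
Proof.
have [[[[v vsub vE] _ _] iX] _ _ _ _] := nd.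
suff v0 : v = 0 by rewrite v0 addr0 in vE.
have Xxs : pX P xs := interior_subset iX.
apply: (interior_normal0 iX) => u Xu.
have [_ /(_ u)] := vsub.
by rewrite /ph /indicator !mem_set// add0e lee_fin.
Qed.

Lemma pos_part_active x (z : 'cV[R]_m) :
  (forall j, j \in J -> 0 < b * pf P j x + z j 0) ->
  (forall j, j \notin J -> b * pf P j x + z j 0 < 0) ->
  forall (F : 'I_m -> 'cV[R]_p),
  \sum_j Num.max 0 (b * pf P j x + z j 0) *: F j =
  \sum_(j in J) (b * pf P j x + z j 0) *: F j.
Proof.
move=> hJ hN F; rewrite [RHS]big_mkcond; apply: eq_bigr => j _.
case: ifPn => jJ; first by rewrite max_r// ltW// hJ.
by rewrite max_l ?scale0r// ltW// hN.
Qed.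

Lemma sum_multipliers_active (V : zmodType) (F : 'I_m -> R -> V) :
  (forall j, F j 0 = 0) -> \sum_j F j (zs j 0) = \sum_(j in J) F j (zs j 0).
Proof.
move=> F0; rewrite [RHS]big_mkcond; apply: eq_bigr => j _.
case: ifPn => // jJ; have [_ _ + _ _] := nd.
by move=> /(_ j jJ)[_ ->]; rewrite F0.
Qed.

Lemma auggrad_kkt : auggrad P b xs ys zs = 0.
Proof.
have [[[_ Axs _] _] hJ hN _ _] := nd.
rewrite /auggrad Axs subrr scaler0 addr0 -[RHS]kkt_interior_stationary.
congr (_ + _); apply: eq_bigr => j _; congr (_ *: _).
have [jJ|jJ] := boolP (j \in J).
  by have [-> h] := hJ j jJ; rewrite mulr0 add0r max_r// ltW.
have [h ->] := hN j jJ; rewrite addr0 max_l//.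
by rewrite pmulr_rle0// ltW.
Qed.

(** Saddle-point property: the Lagrangian at (ys, zs) is convex, has zero gradient at xs, and equals
    g(xs) there by feasibility and complementarity. *)
Lemma lagrangian_ge x :
  pg P xs <= pg P x + dotv ys (pA P *m x - pb P) + \sum_j zs j 0 * pf P j x.
Proof.
have [dg df _ _] := problem_regularity cP.
have [[cg _ _] cf _ _] := cP.
have [[[_ Axs kz] _] hJ hN _ _] := nd.
have hg := convex_grad_le x cg (dg xs).
have hf j : zs j 0 * dotv (grad (pf P j) xs) (x - xs) <= zs j 0 * pf P j x.
  have [z0 f0 c0] := kz j; have [cfj _ _] := cf j.
  have := ler_wpM2l z0 (convex_grad_le x cfj (df j xs)).
  by rewrite mulrDr c0 add0r.
have Hs := ler_sum (index_enum 'I_m) (fun j (_ : xpredT j) => hf j).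
have hA : dotv ys (pA P *m x - pb P) = dotv ((pA P)^T *m ys) (x - xs).
  by rewrite dotv_mull trmxK mulmxBr Axs.
have := congr1 (fun v => dotv v (x - xs)) kkt_interior_stationary.
rewrite dotv0l !dotvDl dotv_suml hA.
under eq_bigr do rewrite dotvZl.
move: hg Hs; rewrite /=; move: (\sum_j _) (\sum_j _) (dotv _ _) (dotv _ _).
move=> u v s t; lra.
Qed.

Lemma auglag_sol_le y z : auglag_smooth P b xs y z <= pg P xs.
Proof.
have [[[_ Axs kz] _] _ _ _ _] := nd.
rewrite /auglag_smooth Axs subrr dotv0r enorm0 expr0n mulr0 !addr0 gerDl.
by apply: sumr_le0 => j _; apply: psi_le0 => //; have [] := kz j.
Qed.

Section DualStep.
Variables (x' : 'cV[R]_p) (y y' : 'cV[R]_q) (z z' : 'cV[R]_m).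
Hypothesis y'E : y' = y + (b / 2) *: (pA P *m x' - pb P).
Hypothesis z'E : forall j,
  z' j 0 = z j 0 + b / 2 * Num.max (- (z j 0 / b)) (pf P j x').

Lemma dual_step_eq :
  dotv y (pA P *m x' - pb P) =
  dotv ys (pA P *m x' - pb P)
  - b / 4 * dotv (pA P *m x' - pb P) (pA P *m x' - pb P)
  + b^-1 * (dotv (y' - ys) (y' - ys) - dotv (y - ys) (y - ys)).
Proof.
have bn : b != 0 by rewrite gt_eqF.
rewrite y'E; have [r rE] : {r | pA P *m x' - pb P = r} by eexists.
rewrite rE (addrAC y); have [w wE] : {w | y - ys = w} by eexists.
rewrite wE !dotvDl !dotvDr !dotvZl !dotvZr (dotvC r w).
have -> : dotv w r = dotv y r - dotv ys r by rewrite -wE dotvBl.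
by field.
Qed.

(** Lower counterpart of [prox_step_decrease]. No sign of [b * f + z] is assumed, so it applies
    before the iterates are known to lie in the ball. *)
Lemma auglag_dual_step :
  pg P x' + dotv ys (pA P *m x' - pb P) + \sum_j zs j 0 * pf P j x'
    + b^-1 * (dotv (y' - ys) (y' - ys) - dotv (y - ys) (y - ys)
              + (dotv (z' - zs) (z' - zs) - dotv (z - zs) (z - zs)))
  <= auglag_smooth P b x' y z.
Proof.
have [[[_ Axs kz] _] _ _ _ _] := nd.
have hz j : zs j 0 * pf P j x'
    + b^-1 * ((z' - zs) j 0 ^+ 2 - (z - zs) j 0 ^+ 2) <= psi b (pf P j x') (z j 0).
  by rewrite !mxE z'E; apply: psi_dual_step => //; have [] := kz j.
have Hs := ler_sum (index_enum 'I_m) (fun j (_ : xpredT j) => hz j).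
move: Hs; rewrite big_split /= -mulr_sumr sumrB => Hs.
have sqE (v : 'cV[R]_m) : dotv v v = \sum_j v j 0 ^+ 2.
  by rewrite dotvE; apply: eq_bigr => j _; rewrite expr2.
rewrite /auglag_smooth dual_step_eq enorm_sq !(sqE _) /Psi.
have h := mulr_ge0 (ltW b0) (dotv_ge0 (pA P *m x' - pb P)).
have [r rE] : {r | pA P *m x' - pb P = r} by eexists.
move: h Hs; rewrite rE.
move: (dotv ys r) (dotv r r) (dotv (y' - ys) _) (dotv (y - ys) _) => u1 u2 u3 u4.
move: (\sum_j psi _ _ _) (\sum_j zs j 0 * _) (\sum_j (z' - zs) j 0 ^+ 2)
  (\sum_j (z - zs) j 0 ^+ 2) => u5 u6 u7 u8.
lra.
Qed.

(** The upper and lower bounds on F(x', y, z) - F(xs, y, z) are combined; the Lagrangian gap and the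
    spare terms are nonnegative and dropped. *)
Lemma weighted_distance_decrease x e :
  pX P x -> pX P x' -> lip_const P b Lg L B x z <= e ->
  0 <= dotv (auggrad P b x y z + e *: (x' - x)) (xs - x') ->
  e / 2 * dotv (x' - xs) (x' - xs)
    + b^-1 * (dotv (y' - ys) (y' - ys) + dotv (z' - zs) (z' - zs))
  <= e / 2 * dotv (x - xs) (x - xs)
    + b^-1 * (dotv (y - ys) (y - ys) + dotv (z - zs) (z - zs)).
Proof.
move=> Xx Xx' Le vi; have [[[_ Axs _] _] _ _ _ _] := nd.
have h1 := prox_step_decrease b0 cP lP Xx Xx' Axs vi.
have h2 := auglag_dual_step; have h3 := auglag_sol_le y z.
have h4 := lagrangian_ge x'.
have h5 := mulr_ge0 (ltW b0) (dotv_ge0 (pA P *m x - pb P)).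
have h6 : 0 <= (e - lip_const P b Lg L B x z) / 2 * dotv (x' - x) (x' - x).
  by rewrite mulr_ge0 ?dotv_ge0// divr_ge0// subr_ge0.
move: h1 h2 h3 h4 h5 h6.
move: (auglag_smooth P b x' y z) (auglag_smooth P b xs y z) => F1 F2.
move: (dotv (pA P *m x - pb P) _) (dotv ys _) (\sum_j _) => t1 t2 t3.
move: (_ * dotv (x' - x) _) => t4.
move: (dotv (y' - ys) _) (dotv (y - ys) _) (dotv (z' - zs) _) (dotv (z - zs) _).
move: (dotv (x' - xs) _) (dotv (x - xs) _) => v1 v2 u1 u2 u3 u4.
lra.
Qed.

Hypothesis actx' : forall j, j \in J -> 0 < b * pf P j x' + z j 0.
Hypothesis inactx' : forall j, j \notin J -> b * pf P j x' + z j 0 < 0.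
Hypothesis actxs : forall j, j \in J -> 0 < b * pf P j xs + z j 0.
Hypothesis inactxs : forall j, j \notin J -> b * pf P j xs + z j 0 < 0.

(** With the active set known, the dual estimate becomes an identity. Off J the value of [psi] is
    -z_j^2 / (2 b) at both x' and xs and cancels, so only multipliers in J occur. *)
Lemma auglag_dual_step_active :
  auglag_smooth P b x' y z - auglag_smooth P b xs y z =
  pg P x' + dotv ys (pA P *m x' - pb P) + \sum_j zs j 0 * pf P j x' - pg P xs
    + b / 4 * (dotv (pA P *m x' - pb P) (pA P *m x' - pb P)
               + \sum_(j in J) pf P j x' ^+ 2)
    + b^-1 * (dotv (y' - ys) (y' - ys) - dotv (y - ys) (y - ys)
              + (\sum_(j in J) (z' - zs) j 0 ^+ 2
                 - \sum_(j in J) (z - zs) j 0 ^+ 2)).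
Proof.
have [[[_ Axs kz] _] hJ _ _ _] := nd.
have hz : Psi P b x' z - Psi P b xs z = \sum_(j in J)
   (zs j 0 * pf P j x' + b / 4 * pf P j x' ^+ 2
    + b^-1 * ((z' - zs) j 0 ^+ 2 - (z - zs) j 0 ^+ 2)).
  rewrite /Psi -sumrB [RHS]big_mkcond; apply: eq_bigr => j _.
  case: ifPn => jJ.
    rewrite !mxE z'E psi_dual_step_active ?(ltW (actx' jJ))//.
    have [fxs _] := hJ j jJ; rewrite fxs /psi mulr0 add0r.
    have := actxs jJ; rewrite fxs mulr0 add0r => /ltW ->.
    by rewrite mul0r expr0n mulr0 addr0 subr0.
  by rewrite /psi !leNgt inactx'// inactxs//= subrr.
rewrite /auglag_smooth Axs subrr dotv0r enorm0 expr0n mulr0 !addr0.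
rewrite opprD addrACA -(addrA (pg P x')) -(addrA (pg P x')) hz.
rewrite !big_split /= -!mulr_sumr sumrB dual_step_eq enorm_sq.
rewrite -(sum_multipliers_active (F := fun j t => t * pf P j x')) => [|j]; last first.
  by rewrite mul0r.
by field; rewrite gt_eqF.
Qed.

End DualStep.

(** The same Lagrangian gap as in [auglag_dual_step_active], with penalty coefficient b / 2 in place
    of b / 4; through it the strong convexity at (ys, zs) reaches the step from w^k. *)
Lemma auglag_kkt_multipliers x :
  (forall j, j \in J -> 0 < b * pf P j x + zs j 0) ->
  (forall j, j \notin J -> b * pf P j x + zs j 0 < 0) ->
  auglag_smooth P b x ys zs - auglag_smooth P b xs ys zs =
  pg P x + dotv ys (pA P *m x - pb P) + \sum_j zs j 0 * pf P j x - pg P xs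
    + b / 2 * (dotv (pA P *m x - pb P) (pA P *m x - pb P)
               + \sum_(j in J) pf P j x ^+ 2).
Proof.
move=> act inact; have [[[_ Axs kz] _] hJ hN _ _] := nd.
have hz : Psi P b x zs - Psi P b xs zs =
   \sum_(j in J) (zs j 0 * pf P j x + b / 2 * pf P j x ^+ 2).
  rewrite /Psi -sumrB [RHS]big_mkcond; apply: eq_bigr => j _.
  case: ifPn => jJ.
    have [fxs z0] := hJ j jJ.
    rewrite fxs /psi mulr0 add0r (ltW z0) (ltW (act j jJ)).
    by rewrite mul0r expr0n mulr0 addr0 subr0 mulrC.
  have [fxs z0] := hN j jJ.
  rewrite /psi !leNgt inact//= z0 addr0 pmulr_rlt0// fxs /=.
  by rewrite subrr.
rewrite /auglag_smooth Axs subrr dotv0r enorm0 expr0n mulr0 !addr0.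
rewrite opprD addrACA -(addrA (pg P x)) hz.
rewrite !big_split /= -!mulr_sumr enorm_sq.
rewrite -(sum_multipliers_active (F := fun j t => t * pf P j x)) => [|j]; last first.
  by rewrite mul0r.
by field.
Qed.

(** Subtracting the KKT stationarity equation from the one at x writes D w, with w the multiplier
    errors, as minus a sum of four vectors. Then nu |w|^2 <= |D w|^2, and two levels of [dotv_young]
    give the factor 4. *)
Lemma dual_error_bound x (y : 'cV[R]_q) (z : 'cV[R]_m) d e nu gamma :
  pX P x -> auggrad P b x y z + e *: d = 0 ->
  (forall j, j \in J -> 0 < b * pf P j x + z j 0) ->
  (forall j, j \notin J -> b * pf P j x + z j 0 < 0) ->
  dotv (z - zs) (z - zs) <= gamma ^+ 2 ->
  smallest_eigenvalue ((constraint_mx P xs)^T *m constraint_mx P xs) nu ->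
  nu * (dotv (y - ys) (y - ys) + \sum_(j in J) (z - zs) j 0 ^+ 2) <=
  4 * (Cconst b Lg L B J zs gamma * dotv (x - xs) (x - xs)
       + (b ^+ 2 * specnorm (pA P) ^+ 2) * dotv (pA P *m x - pb P) (pA P *m x - pb P)
       + e ^+ 2 * dotv d d).
Proof.
move=> Xx stat act inact zg ev.
have [[[_ Axs kz] iX] hJ hN _ _] := nd.
have [Lg0 LB lg lf bf] := lP; have [_ _ cX _] := cP.
have [_ df _ _] := problem_regularity cP.
have Xxs : pX P xs := interior_subset iX.
pose D := constraint_mx P xs.
(* Padding with zeros off J makes w a vector on which the full matrix D acts, so that nu applies. *)
pose wz : 'cV[R]_m := \col_j (if j \in J then (z - zs) j 0 else 0).
have wzE j : wz j 0 = if j \in J then (z - zs) j 0 else 0 by rewrite mxE.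
pose w := col_mx (y - ys) wz.
have Dsym : (D^T *m D)^T = D^T *m D by rewrite trmx_mul trmxK.
have := smallest_eigenvalue_rayleigh Dsym ev w.
rewrite -mulmxA [dotv w (_ *m _)]dotvC dotv_mull trmxK.
have ww : dotv w w = dotv (y - ys) (y - ys) + \sum_(j in J) (z - zs) j 0 ^+ 2.
  rewrite /dotv /w tr_col_mx mul_row_col mxE; congr (_ + _).
  rewrite -/(dotv wz wz) dotvE [RHS]big_mkcond; apply: eq_bigr => j _.
  rewrite wzE; case: ifP; first by rewrite expr2.
  by rewrite mul0r.
rewrite ww => /le_trans; apply.
pose g1 := grad (pg P) x - grad (pg P) xs.
(* What is left of (b f_j(x) + z_j) grad f_j(x) - zs_j grad f_j(xs) after removing (z_j - zs_j) grad
   f_j(xs), which belongs to D w. *)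
pose g2 := \sum_(j in J) ((b * pf P j x) *: grad (pf P j) x
   + z j 0 *: (grad (pf P j) x - grad (pf P j) xs)).
pose g3 := b *: ((pA P)^T *m (pA P *m x - pb P)).
have Dw : D *m w = - ((g1 + g2) + (g3 + e *: d)).
  have e1 : D *m w = (pA P)^T *m (y - ys)
      + \sum_(j in J) (z - zs) j 0 *: grad (pf P j) xs.
    rewrite /D /constraint_mx /w mul_row_col; congr (_ + _).
    apply/colP => i; rewrite mxE summxE [RHS]big_mkcond; apply: eq_bigr => j _.
    rewrite wzE mxE mulrC; case: ifP; last by rewrite mul0r.
    by rewrite [RHS]mxE.
  have s1 := kkt_interior_stationary.
  rewrite (sum_multipliers_active (F := fun j t => t *: grad (pf P j) xs)) in s1.
    move: stat; rewrite /auggrad pos_part_active// => s2.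
    have S2 : \sum_(j in J) (b * pf P j x + z j 0) *: grad (pf P j) x =
        g2 + \sum_(j in J) (z - zs) j 0 *: grad (pf P j) xs
        + \sum_(j in J) zs j 0 *: grad (pf P j) xs.
      rewrite -!big_split /=; apply: eq_bigr => j _.
      by apply/colP => i; rewrite !mxE; ring.
    rewrite /= in s1; rewrite e1 /g3 [_ *m (y - ys)]mulmxBr.
    rewrite S2 mulmxDr -scalemxAr in s2.
    apply/eqP; rewrite -addr_eq0; apply/eqP.
    apply: etrans (etrans (congr2 (fun u v => u - v) s2 s1) (subrr 0)).
    rewrite /g1 /=.
    clear S2 s1 s2; clearbody g2.
    move: g2 (\sum_(j in J) (z - zs) j 0 *: grad (pf P j) xs).
    move: (\sum_(j in J) zs j 0 *: grad (pf P j) xs).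
    move: ((pA P)^T *m y) ((pA P)^T *m ys) ((pA P)^T *m (pA P *m x - pb P)).
    move: (grad _ x) (grad _ xs) => v1 v2 v3 v4 v5 v6 v7 v8.
    by apply/colP => i; rewrite !mxE; ring.
  by move=> j; rewrite scale0r.
rewrite Dw dotvNl dotvNr opprK.
apply: (le_trans (dotv_young _ _)).
have y1 := dotv_young g1 g2; have y2 := dotv_young g3 (e *: d).
have b1 : dotv g1 g1 <= Lg ^+ 2 * dotv (x - xs) (x - xs).
  by rewrite -(enorm_sq (x - xs)) -exprMn -enorm_leP ?mulr_ge0 ?enorm_ge0// lg.
have b3 : dotv g3 g3 <= b ^+ 2 * specnorm (pA P) ^+ 2
    * dotv (pA P *m x - pb P) (pA P *m x - pb P).
  rewrite /g3 dotvZl dotvZr mulrA -expr2 -mulrA ler_wpM2l ?sqr_ge0//.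
  rewrite -(enorm_sq (_ - _)) -exprMn -enorm_leP ?enorm_mul_tr//.
  by rewrite mulr_ge0 ?specnorm_ge0 ?enorm_ge0.
have b4 : dotv (e *: d) (e *: d) = e ^+ 2 * dotv d d.
  by rewrite dotvZl dotvZr mulrA -expr2.
set Lmax := \big[Num.max/0]_j L j.
have LjM j : 0 <= L j <= Lmax by rewrite (LB j).1 /=; exact: le_bigmax.
(* Since f_j(xs) = 0 on J, |f_j(x)| <= B_j |x - xs|, whence b^2 B_j^4. The other part uses |z|^2 <=
   2 (|zs|^2 + gamma^2). *)
have b2 : dotv g2 g2 <= (2 * #|J|%:R * (\sum_(j in J) b ^+ 2 * B j ^+ 4
    + 2 * Lmax ^+ 2 * (enorm zs ^+ 2 + gamma ^+ 2))) * dotv (x - xs) (x - xs).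
  rewrite /g2 big_split /=; apply: (le_trans (dotv_young _ _)).
  have := dotv_sum_le J (fun j => (b * pf P j x) *: grad (pf P j) x).
  have := dotv_sum_le J (fun j => z j 0 *: (grad (pf P j) x - grad (pf P j) xs)).
  set u1 := dotv _ _; set u2 := \sum_(j in J) _; set u3 := dotv _ _.
  set u4 := \sum_(j in J) _; move=> h1 h2.
  have u4le : u4 <= (\sum_(j in J) b ^+ 2 * B j ^+ 4) * dotv (x - xs) (x - xs).
    rewrite mulr_suml; apply: ler_sum => j jJ; have [fxs _] := hJ j jJ.
    have [L0 B0] := LB j.
    have f1 : pf P j x ^+ 2 <= B j ^+ 2 * dotv (x - xs) (x - xs).
      rewrite -enorm_sq -exprMn; apply: sq_le_of_lipschitz.
        have := grad_bound_lipschitz cX (df j) (bf j) Xxs Xx.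
        by rewrite fxs subr0.
      have := grad_bound_lipschitz cX (df j) (bf j) Xx Xxs.
      by rewrite fxs sub0r enormB.
    have f2 : dotv (grad (pf P j) x) (grad (pf P j) x) <= B j ^+ 2.
      by rewrite -enorm_leP// bf.
    have -> : b ^+ 2 * B j ^+ 4 * dotv (x - xs) (x - xs) =
      b ^+ 2 * ((B j ^+ 2 * dotv (x - xs) (x - xs)) * B j ^+ 2) by ring.
    have -> : dotv ((b * pf P j x) *: grad (pf P j) x)
        ((b * pf P j x) *: grad (pf P j) x) =
      b ^+ 2 * (pf P j x ^+ 2 * dotv (grad (pf P j) x) (grad (pf P j) x)).
      by rewrite dotvZl dotvZr; ring.
    rewrite ler_wpM2l ?sqr_ge0//.
    by apply: ler_pM => //; rewrite ?sqr_ge0 ?dotv_ge0.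
  have u2le : u2 <= (2 * Lmax ^+ 2 * (enorm zs ^+ 2 + gamma ^+ 2))
      * dotv (x - xs) (x - xs).
    have zz : \sum_(j in J) z j 0 ^+ 2 <= 2 * (enorm zs ^+ 2 + gamma ^+ 2).
      apply: (@le_trans _ _ (dotv z z)).
        rewrite dotvE big_mkcond; apply: ler_sum => j _.
        by rewrite -expr2; case: ifP => // _; exact: sqr_ge0.
      have := dotv_young zs (z - zs); rewrite addrC subrK enorm_sq; lra.
    apply: (@le_trans _ _ (\sum_(j in J) z j 0 ^+ 2
        * (Lmax ^+ 2 * dotv (x - xs) (x - xs)))).
      apply: ler_sum => j jJ; rewrite dotvZl dotvZr mulrA -expr2.
      rewrite ler_wpM2l ?sqr_ge0//; have /andP[l0 l1] := LjM j.
      rewrite -(enorm_sq (x - xs)) -exprMn -enorm_leP ?mulr_ge0 ?enorm_ge0//.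
        by apply: (le_trans (lf j _ _ Xx Xxs)); rewrite ler_wpM2r ?enorm_ge0.
      exact: le_trans l1.
    rewrite -mulr_suml; have := ler_wpM2r (mulr_ge0 (sqr_ge0 Lmax) (dotv_ge0 (x - xs))) zz.
    by move=> /le_trans; apply; rewrite le_eqVlt; apply/orP; left; apply/eqP; ring.
  have J0 : 0 <= 2 * #|J|%:R :> R by rewrite mulr_ge0.
  have := ler_wpM2l J0 (lerD u4le u2le).
  rewrite -mulrDl mulrA => /(le_trans _); apply; lra.
rewrite /Cconst -/Lmax [X in 4 * (X + _ + _)]mulrDl; rewrite b4 in y2.
lra.
Qed.

End KKT.

(** * Extended-real fractions and the scalar contraction inequality *)

Section Scalars.
Variable R : realType.

(** The weight 1 / a may be +oo, as [eta_low] can vanish; the product with Y is then +oo, or 0 if Y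
    = 0. *)
Lemma ler_one_div (a c Y : R) : 0 <= a -> a <= c -> 0 < c -> 0 <= Y ->
  ((Y / c)%:E <= 1 / a%:E * Y%:E)%E.
Proof.
move=> a0 ac c0 Y0; rewrite mul1e inver; case: eqVneq => [_|an].
  have [->|Yn] := eqVneq Y 0; first by rewrite mul0r mule0.
  by rewrite gt0_mulye ?leey// lte_fin lt_def Yn.
have ap : 0 < a by rewrite lt_def an.
by rewrite -EFinM lee_fin mulrC ler_wpM2r// lef_pV2 ?posrE.
Qed.

Lemma lte_div_mul (a s t : R) : 0 < s -> 0 <= t ->
  (a%:E < s%:E / t%:E)%E -> a * t < s.
Proof.
move=> s0 t0; rewrite inver; case: eqVneq => [-> _|tn]; first by rewrite mulr0.
by rewrite -EFinM lte_fin ltr_pdivlMr// lt_def tn.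
Qed.

(** Primes mark step k+1. X is the squared primal distance; rr = |A x^k - b|^2, dd = |x^{k+1} -
    x^k|^2; br is the Lagrangian gap at x^{k+1} and Q the squared residuals there, of A and of f_j
    for j in J; Dy, DJ, DN are the squared errors of y, of z on J and of z off J; a is the norm of A
    and l is [lip_const]. *)
Lemma contraction_scalars (b mu eta eta' eta_bar delta nu alpha a C sigma : R)
    (X X' rr dd Q br Dy Dy' DJ DJ' DN DN' dF l : R) :
  0 < b -> 0 <= mu -> 0 <= eta -> eta <= eta_bar -> 0 <= C -> 0 <= alpha ->
  0 <= X -> 0 <= X' -> 0 <= rr -> 0 <= dd -> 0 <= Q -> 0 <= br ->
  0 <= Dy -> 0 <= DJ -> 0 <= DN ->
  dF + b / 2 * rr + (eta - l) / 2 * dd <= eta / 2 * (X - X') ->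
  dF = br + b / 4 * Q + b^-1 * (Dy' - Dy + (DJ' - DJ)) ->
  mu / 4 * X' <= br + b / 2 * Q ->
  nu * (Dy + DJ) <= 4 * (C * X + b ^+ 2 * a ^+ 2 * rr + eta ^+ 2 * dd) ->
  alpha * (b * a ^+ 2) <= 1 -> alpha * eta_bar ^+ 2 <= delta -> l + delta <= eta ->
  DN' = DN / 4 -> eta' <= eta + mu / 8 ->
  alpha * C + eta_bar <= sigma * (mu / 8 + eta_bar) ->
  1 - alpha * b * nu / 8 <= sigma -> 1 / 4 <= sigma -> sigma <= 1 ->
  (mu / 16 + eta' / 2) * X' + b^-1 * (Dy' + (DJ' + DN')) <=
  sigma * ((mu / 16 + eta / 2) * X + b^-1 * (Dy + (DJ + DN))).
Proof.
move=> b0 mu0 eta0 etale C0 al0 X0 X'0 rr0 dd0 Q0 br0 Dy0 DJ0 DN0.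
move=> h1 h2 h3 h4 hA hdel hl hN heta s1 s2 s3 s4.
have bi : 0 < b^-1 by rewrite invr_gt0.
have bbi : b * b^-1 = 1 by rewrite divff// gt_eqF.
(* Half of [h3] gives mu / 8 X' <= br / 2 + b / 4 Q, and the other half of br is nonnegative. *)
have e1 : (mu / 8 + eta / 2) * X' + b^-1 * (Dy' + DJ') <=
    eta / 2 * X + b^-1 * (Dy + DJ) - b / 2 * rr - delta / 2 * dd.
  have : delta / 2 * dd <= (eta - l) / 2 * dd by rewrite ler_wpM2r//; lra.
  lra.
(* The error bound times alpha / 8: the upper bounds on alpha make its last two terms fit into the
   spare terms of [e1]. *)
have e2 : alpha * nu / 8 * (Dy + DJ) <=
    alpha * C / 2 * X + b / 2 * rr + delta / 2 * dd.
  have t1 := ler_wpM2l al0 h4.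
  have t2 : b / 2 * rr * (alpha * (b * a ^+ 2)) <= b / 2 * rr * 1.
    by rewrite ler_wpM2l// mulr_ge0// divr_ge0// ltW.
  have t3 : alpha * eta ^+ 2 * dd <= delta * dd.
    rewrite ler_wpM2r//; apply: le_trans hdel; rewrite ler_wpM2l//.
    by rewrite ler_sqr ?nnegrE//; lra.
  have -> : alpha * nu / 8 * (Dy + DJ) = alpha * (nu * (Dy + DJ)) / 8 by field.
  have t4 : alpha * (4 * (C * X + b ^+ 2 * a ^+ 2 * rr + eta ^+ 2 * dd)) / 8 =
    alpha * C / 2 * X + b / 2 * rr * (alpha * (b * a ^+ 2))
    + alpha * eta ^+ 2 * dd / 2 by field.
  lra.
(* Because sigma <= 1, the requirement is strongest at eta = eta_bar, where [s1] provides it. *)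
have e3 : (alpha * C + eta) / 2 * X <= sigma * (mu / 16 + eta / 2) * X.
  rewrite ler_wpM2r//.
  have : sigma * (eta_bar - eta) <= 1 * (eta_bar - eta) by rewrite ler_wpM2r//; lra.
  lra.
have e4 : b^-1 * (1 - alpha * b * nu / 8) * (Dy + DJ) <= b^-1 * sigma * (Dy + DJ).
  by rewrite ler_wpM2r ?addr_ge0// ler_wpM2l// ltW.
have e5 : b^-1 * (1 - alpha * b * nu / 8) * (Dy + DJ) =
   b^-1 * (Dy + DJ) - alpha * nu / 8 * (Dy + DJ) by field; rewrite gt_eqF.
have e6 : b^-1 * DN' <= b^-1 * (sigma * DN).
  rewrite ler_wpM2l ?(ltW bi)// hN.
  by have := ler_wpM2r DN0 s3; lra.
have e7 : eta' / 2 * X' <= (eta + mu / 8) / 2 * X' by rewrite ler_wpM2r//; lra.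
lra.
Qed.

End Scalars.

(** * Boundedness, localization and contraction of the iterates *)

Section Iterates.
Variables (R : realType) (p q m : nat) (P : problem R p q m) (Lg : R).
Variables (L B : 'I_m -> R).
Variables (xs : 'cV[R]_p) (ys : 'cV[R]_q) (zs : 'cV[R]_m) (J : {set 'I_m}).
Variables (b delta mu gamma eta_bar : R).
Variables (x : nat -> 'cV[R]_p) (y : nat -> 'cV[R]_q) (z : nat -> 'cV[R]_m).
Variable eta : nat -> R.
Hypothesis b0 : 0 < b.
Hypothesis cP : convex_problem P.
Hypothesis lP : lipschitz_assumption P Lg L B.
Hypothesis nd : nondegenerate_kkt P xs ys zs J.
Hypothesis delta0 : 0 < delta.
Hypothesis gamma0 : 0 < gamma.
Hypothesis lr : local_radius P b mu xs ys zs J gamma.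
Hypothesis alg : lalm P b (b / 2) (b / 2) delta Lg L B x y z eta.
Hypothesis eta_bar_ge : eta_bar_rhs P b (b / 2) (b / 2) delta Lg L B xs ys zs
  (x 0%N) (y 0%N) (z 0%N) (eta 0%N) eta_bar <= eta_bar.

Local Notation lip k := (lip_const P b Lg L B (x k) (z k)).

(** Mirrors the terms of [eta_bar_rhs]; f_j(xs) <= 0 gives f_j(u) <= B_j |u - xs|. *)
Lemma lip_const_le u w : pX P u ->
  lip_const P b Lg L B u w <=
  Lg + b * specnorm (pA P) ^+ 2 + b * \sum_j B j ^+ 2
  + b * (\sum_j B j * L j) * enorm (u - xs)
  + Num.sqrt (\sum_j L j ^+ 2) * (enorm zs + enorm (w - zs)).
Proof.
move=> Xu; have [Lg0 LB lg lf bf] := lP.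
have [[[_ _ kz] iX] _ _ _ _] := nd; have Xxs : pX P xs := interior_subset iX.
have [_ df _ _] := problem_regularity cP; have [_ _ cX _] := cP.
have hj j : L j * Num.max 0 (b * pf P j u + w j 0) <=
    b * (B j * L j) * enorm (u - xs) + L j * `|w j 0|.
  have [L0 B0] := LB j; have [_ f0 _] := kz j.
  have h := grad_bound_lipschitz cX (df j) (bf j) Xxs Xu.
  have h' : b * pf P j u <= b * (B j * enorm (u - xs)) by rewrite ler_pM2l//; lra.
  have -> : b * (B j * L j) * enorm (u - xs) + L j * `|w j 0| =
    L j * (b * (B j * enorm (u - xs)) + `|w j 0|) by ring.
  rewrite ler_wpM2l// ge_max addr_ge0 ?mulr_ge0 ?enorm_ge0 ?(ltW b0)//=.
  by rewrite lerD// ler_norm.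
have Hs := ler_sum (index_enum 'I_m) (fun j (_ : xpredT j) => hj j).
have hc : \sum_j L j * `|w j 0| <= Num.sqrt (\sum_j L j ^+ 2) * enorm w.
  have s0 : 0 <= \sum_j L j * `|w j 0|.
    by apply: sumr_ge0 => j _; rewrite mulr_ge0 ?(LB j).1.
  rewrite -[X in X <= _](ger0_norm s0) -sqrtr_sqr /enorm -sqrtrM; last first.
    by apply: sumr_ge0 => j _; exact: sqr_ge0.
  apply: ler_wsqrtr; apply: (le_trans (sum_cauchy _ _ _)).
  rewrite dotvE le_eqVlt; apply/orP; left; apply/eqP; congr (_ * _).
  by apply: eq_bigr => j _; rewrite real_normK ?num_real// expr2.
have hw : enorm w <= enorm zs + enorm (w - zs).
  by have := enormD zs (w - zs); rewrite addrC subrK.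
have := ler_wpM2l (sqrtr_ge0 (\sum_j L j ^+ 2)) hw.
move: Hs; rewrite big_split /= -mulr_suml -mulr_sumr => Hs h.
by rewrite /lip_const big_split /= -mulr_sumr; lra.
Qed.

Local Notation a0 := (enorm (x 0%N - xs)).
Local Notation c0 := (enorm (y 0%N - ys)).
Local Notation d0 := (enorm (z 0%N - zs)).
(** Normalized so that [eta 0%N * W0] is the initial value of the Fejer quantity
    [e k * X k + 2 / b * D k]. *)
Local Notation W0 := (a0 ^+ 2 + (c0 ^+ 2 + d0 ^+ 2) / (b / 2 * eta 0%N)).

Lemma eta_ge_lip k : lip k + delta <= eta k.
Proof. by have [-> _ _ _] := alg k; rewrite le_max lexx orbT. Qed.

Lemma eta_le_succ k : eta k <= eta k.+1.
Proof. by have [-> _ _ _] := alg k.+1; rewrite le_max lexx. Qed.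

Lemma lip_ge0 k : 0 <= lip k.
Proof. exact: lip_const_ge0. Qed.

Lemma eta_gt0 k : 0 < eta k.
Proof. by have := eta_ge_lip k; have := lip_ge0 k; have := delta0; lra. Qed.

Lemma eta0E : eta 0%N = lip 0%N + delta.
Proof.
have [-> _ _ _] := alg 0%N; rewrite max_r//.
by have := lip_ge0 0%N; have := delta0; lra.
Qed.

Lemma rhs_terms_ge0 :
  [/\ 0 <= \sum_j B j ^+ 2, 0 <= \sum_j B j * L j,
      0 <= Num.sqrt (\sum_j L j ^+ 2) & 0 <= Lg + b * specnorm (pA P) ^+ 2].
Proof.
have [Lg0 LB _ _ _] := lP; split.
- by apply: sumr_ge0 => j _; exact: sqr_ge0.
- by apply: sumr_ge0 => j _; have [] := LB j => ? ?; rewrite mulr_ge0.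
- exact: sqrtr_ge0.
- by rewrite addr_ge0// mulr_ge0 ?sqr_ge0// ltW.
Qed.

Local Notation rho_eta0 := (Num.sqrt (b / 2 * eta 0%N)).

Lemma eta_bar_ge_kkt :
  delta + (Lg + b * specnorm (pA P) ^+ 2 + b * \sum_j B j ^+ 2
    + Num.sqrt (\sum_j L j ^+ 2) * enorm zs) <= eta_bar.
Proof.
apply: le_trans eta_bar_ge; rewrite /eta_bar_rhs.
have [h1 h2 h3 h4] := rhs_terms_ge0.
set u := b * (\sum_j B j * L j) * _; set v := _ * enorm (x 0%N - xs).
set w := _ * enorm (y 0%N - ys); set t := _ * enorm (z 0%N - zs).
have u0 : 0 <= u.
  by rewrite !mulr_ge0 ?(ltW b0)// !addr_ge0 ?divr_ge0 ?enorm_ge0 ?sqrtr_ge0.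
have v0 : 0 <= v by rewrite mulr_ge0 ?sqrtr_ge0 ?enorm_ge0.
have w0 : 0 <= w by rewrite mulr_ge0 ?sqrtr_ge0 ?enorm_ge0.
have t0 : 0 <= t by rewrite mulr_ge0 ?enorm_ge0// le_max ler01.
have := mulr_ge0 h3 (addr_ge0 (addr_ge0 v0 w0) t0).
by move: h3; move: (Num.sqrt (\sum_j _)) => s h3; rewrite !mulrDr; lra.
Qed.

Lemma eta_bar_gt0 : 0 < eta_bar.
Proof.
have [h1 h2 h3 h4] := rhs_terms_ge0.
have := eta_bar_ge_kkt; have := mulr_ge0 h3 (enorm_ge0 zs).
by have := mulr_ge0 (ltW b0) h1; have := delta0; lra.
Qed.

Lemma lip_kkt_le : lip_const P b Lg L B xs zs <= eta_bar.
Proof.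
have [[[_ _ kz] iX] _ _ _ _] := nd.
apply: (le_trans (lip_const_le zs (interior_subset iX))).
rewrite !subrr !enorm0 mulr0 addr0 addr0.
by have := eta_bar_ge_kkt; have := delta0; lra.
Qed.

(** At the start eta^0 <= eta_bar is still to be proved, so eta_bar / eta^0 might be below 1; the 1
    in the maximum of [eta_bar_rhs] covers the term in d0. *)
Lemma lip_init_le : pX P (x 0%N) -> lip 0%N + delta <= eta_bar.
Proof.
move=> X0; apply: le_trans eta_bar_ge; rewrite /eta_bar_rhs.
have [h1 h2 h3 h4] := rhs_terms_ge0.
set M := Num.max _ _; set v := _ * a0; set w := _ * c0.
have := lip_const_le (z 0%N) X0.
have v0 : 0 <= v by rewrite mulr_ge0 ?sqrtr_ge0 ?enorm_ge0.
have w0 : 0 <= w by rewrite mulr_ge0 ?sqrtr_ge0 ?enorm_ge0.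
have M1 : d0 <= M * d0 by rewrite ler_peMl ?enorm_ge0// le_max lexx.
have r0 : 0 <= c0 / rho_eta0 + d0 / rho_eta0.
  by rewrite addr_ge0 ?divr_ge0 ?enorm_ge0 ?sqrtr_ge0.
have := mulr_ge0 (mulr_ge0 (ltW b0) h2) r0.
have : Num.sqrt (\sum_j L j ^+ 2) * (enorm zs + d0) <=
  Num.sqrt (\sum_j L j ^+ 2) * (v + w + enorm zs + M * d0).
  by rewrite ler_wpM2l//; lra.
rewrite [b * _ * (a0 + _ + _)]mulrDr [b * _ * (a0 + _)]mulrDr [b * _ * (_ + _)]mulrDr.
move: (Num.sqrt (\sum_j _) * _) (Num.sqrt (\sum_j _) * _) => u1 u2; lra.
Qed.

Local Notation S0 := (a0 + c0 / rho_eta0 + d0 / rho_eta0).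

Lemma W0_le_sq : 0 <= S0 /\ W0 <= S0 ^+ 2.
Proof.
have r0 : 0 < b / 2 * eta 0%N by rewrite mulr_gt0 ?divr_gt0 ?eta_gt0.
have a_0 : 0 <= a0 by exact: enorm_ge0.
have c_0 : 0 <= c0 / rho_eta0 by rewrite divr_ge0 ?enorm_ge0 ?sqrtr_ge0.
have d_0 : 0 <= d0 / rho_eta0 by rewrite divr_ge0 ?enorm_ge0 ?sqrtr_ge0.
split; first by rewrite !addr_ge0.
have -> : W0 = a0 ^+ 2 + (c0 / rho_eta0) ^+ 2 + (d0 / rho_eta0) ^+ 2.
  by rewrite !expr_div_n (sqr_sqrtr (ltW r0)) mulrDl addrA.
move: (c0 / _) (d0 / _) c_0 d_0 => c d c_0 d_0.
have := mulr_ge0 a_0 c_0; have := mulr_ge0 a_0 d_0; have := mulr_ge0 c_0 d_0.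
lra.
Qed.

(** Closes the circle: the dual bound is stated with eta_bar itself, and the terms of [eta_bar_rhs]
    containing eta_bar majorize sqrt (b / 2 eta_bar) [S0]. *)
Lemma lip_iterate_le u w : pX P u -> dotv (u - xs) (u - xs) <= W0 ->
  dotv (w - zs) (w - zs) <= b / 2 * eta_bar * W0 ->
  lip_const P b Lg L B u w + delta <= eta_bar.
Proof.
move=> Xu hu hw; have [S_0 WS] := W0_le_sq.
have [h1 h2 h3 h4] := rhs_terms_ge0.
have e0 := eta_bar_gt0.
have r0 : 0 < b / 2 * eta 0%N by rewrite mulr_gt0 ?divr_gt0 ?eta_gt0.
have r1 : 0 < b / 2 * eta_bar by rewrite mulr_gt0 ?divr_gt0.
have nu : enorm (u - xs) <= S0 by rewrite enorm_leP// (le_trans hu).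
have nw : enorm (w - zs) <= Num.sqrt (b / 2 * eta_bar) * S0.
  rewrite enorm_leP ?mulr_ge0 ?sqrtr_ge0// exprMn sqr_sqrtr ?(ltW r1)//.
  by apply: (le_trans hw); rewrite ler_pM2l.
apply: le_trans eta_bar_ge; rewrite /eta_bar_rhs.
have -> : Num.sqrt (b / 2 * eta_bar / (b / 2 * eta 0%N)) =
    Num.sqrt (b / 2 * eta_bar) / rho_eta0 by rewrite sqrtrM ?(ltW r1)// sqrtrV ?ltW.
have M1 : Num.sqrt (b / 2 * eta_bar) / rho_eta0 * d0 <=
    Num.max 1 (Num.sqrt (eta_bar / eta 0%N)) * d0.
  rewrite ler_wpM2r ?enorm_ge0// le_max; apply/orP; right.
  rewrite -sqrtrV ?(ltW r0)// -sqrtrM ?(ltW r1)//.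
  rewrite (_ : _ / _ = eta_bar / eta 0%N)//.
  by field; rewrite !gt_eqF ?eta_gt0.
have := lip_const_le w Xu.
have : b * (\sum_j B j * L j) * enorm (u - xs) <= b * (\sum_j B j * L j) * S0.
  by rewrite ler_wpM2l// mulr_ge0// ltW.
have : Num.sqrt (\sum_j L j ^+ 2) * (enorm zs + enorm (w - zs)) <=
  Num.sqrt (\sum_j L j ^+ 2) * (Num.sqrt (b / 2 * eta_bar) * a0
    + Num.sqrt (b / 2 * eta_bar) / rho_eta0 * c0 + enorm zs
    + Num.max 1 (Num.sqrt (eta_bar / eta 0%N)) * d0).
  rewrite ler_wpM2l//; apply: le_trans (lerD (lexx (enorm zs)) nw) _.
  move: M1; move: (rho_eta0^-1) (Num.sqrt (b / 2 * eta_bar)) => ri s.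
  by move: (Num.max _ _) => M; lra.
move: (Num.sqrt (\sum_j _) * _) (Num.sqrt (\sum_j _) * _) => u1 u2.
move: (b * _ * enorm _) (b * _ * S0) => u3 u4; lra.
Qed.

Hypothesis W0_le : W0 <= gamma ^+ 2.
Hypothesis W0_le_dual : b / 2 * eta_bar * W0 <= gamma ^+ 2.

Lemma local_ball u v w : dotv (u - xs) (u - xs) <= gamma ^+ 2 ->
  dotv (v - ys) (v - ys) <= gamma ^+ 2 -> dotv (w - zs) (w - zs) <= gamma ^+ 2 ->
  [/\ (pX P)° u, forall j, j \in J -> 0 < b * pf P j u + w j 0,
      forall j, j \notin J -> b * pf P j u + w j 0 < 0 &
      psd (hess_auglag P b u v w - (mu / 2)%:M)].
Proof.
by move=> hu hv hw; apply: lr; rewrite !ge_max !enorm_leP ?(ltW gamma0)// hu hv hw.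
Qed.

Lemma dotv_subrr_le n (u : 'cV[R]_n) : dotv (u - u) (u - u) <= gamma ^+ 2.
Proof. by rewrite subrr dotv0r sqr_ge0. Qed.

Lemma prox_optimality k : pX P (x k.+1) /\ forall u, pX P u ->
  0 <= dotv (auggrad P b (x k) (y k) (z k) + eta k *: (x k.+1 - x k)) (u - x k.+1).
Proof.
have [_ _ cX _] := cP; have [[_ iX] _ _ _ _] := nd.
have [dg df _ _] := problem_regularity cP.
have [_ am _ _] := alg k.
apply: (argmin_indicator cX (ltW (eta_gt0 k)) (interior_subset iX)).
by move: am; rewrite /ph grad_auglagE.
Qed.

Local Notation X k := (dotv (x k - xs) (x k - xs)).
Local Notation D k := (dotv (y k - ys) (y k - ys) + dotv (z k - zs) (z k - zs)).
(* At k = 0 this is eta^0, not the value eta^{-1} = 0 of the algorithm. *)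
Definition prev_eta k := if k is k'.+1 then eta k' else eta 0%N.
Local Notation e := prev_eta.

Lemma e_gt0 k : 0 < e k. Proof. by case: k => [|k]; exact: eta_gt0. Qed.

Lemma e_le_eta k : e k <= eta k.
Proof. by case: k => [|k] //; exact: eta_le_succ. Qed.

Lemma D_ge0 k : 0 <= D k. Proof. by rewrite addr_ge0 ?dotv_ge0. Qed.

Lemma fejer_bounds k : e k * X k + 2 / b * D k <= e k * W0 ->
  X k <= W0 /\ D k <= b / 2 * e k * W0.
Proof.
move=> h; have ek := e_gt0 k; have Dk := D_ge0 k.
have X0 : 0 <= X k := dotv_ge0 _.
have b2 : 0 < 2 / b by rewrite divr_gt0.
split; first by rewrite -(ler_pM2l ek); have := mulr_ge0 (ltW b2) Dk; lra.
rewrite -(ler_pM2l b2).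
have -> : 2 / b * (b / 2 * e k * W0) = e k * W0 by field; rewrite !gt_eqF ?eta_gt0.
by have := mulr_ge0 (ltW ek) X0; lra.
Qed.

(** The Fejer bound at k+1 is weighted by [eta k], already at most eta_bar; it bounds the new
    iterate, hence [eta k.+1], by [lip_iterate_le]. *)
Lemma lalm_invariant k :
  [/\ pX P (x k), e k * X k + 2 / b * D k <= e k * W0 & eta k <= eta_bar].
Proof.
have fin n : pX P (x n) -> e n * X n + 2 / b * D n <= e n * W0 ->
    e n <= eta_bar -> lip n + delta <= eta_bar.
  move=> Xn hn en; have [h1 h2] := fejer_bounds hn.
  apply: lip_iterate_le => //.
  have : b / 2 * e n * W0 <= b / 2 * eta_bar * W0.
    have W00 : 0 <= W0 by apply: le_trans h1; exact: dotv_ge0.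
    by rewrite ler_wpM2r// ler_wpM2l// divr_ge0// ltW.
  by have := dotv_ge0 (y n - ys); move: h2; lra.
elim: k => [|k [Xk hk ek]].
  (* Membership of the initial point comes from the ball, which [local_radius] places inside the
     set. *)
  have X0 : pX P (x 0%N).
    have c : dotv (x 0%N - xs) (x 0%N - xs) <= gamma ^+ 2.
      apply: le_trans W0_le; rewrite -enorm_sq lerDl.
      by rewrite divr_ge0 ?addr_ge0 ?sqr_ge0// mulr_ge0 ?divr_ge0 ?ltW ?eta_gt0.
    have [iX _ _ _] := local_ball c (dotv_subrr_le ys) (dotv_subrr_le zs).
    exact: interior_subset iX.
  split=> //; last by rewrite eta0E; exact: lip_init_le.
  rewrite /prev_eta -!enorm_sq.
  rewrite le_eqVlt; apply/orP; left; apply/eqP.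
  by field; rewrite !gt_eqF ?eta_gt0.
have [Xk' vi] := prox_optimality k.
have [[_ iX] _ _ _ _] := nd.
have [_ _ y'E z'E] := alg k.
have lk : lip k <= eta k by have := eta_ge_lip k; have := delta0; lra.
have h := weighted_distance_decrease b0 cP lP nd y'E z'E Xk Xk' lk
  (vi _ (interior_subset iX)).
have hk' : e k.+1 * X k.+1 + 2 / b * D k.+1 <= e k.+1 * W0.
  have [h1 _] := fejer_bounds hk.
  (* Raises the weight from [e k] to [eta k], at no loss since X k <= W0. *)
  have h2 : (eta k - e k) * X k <= (eta k - e k) * W0.
    by rewrite ler_wpM2l// subr_ge0 e_le_eta.
  move: h; rewrite /=; lra.
split=> //.
have [-> _ _ _] := alg k.+1; rewrite ge_max ek /=.
exact: fin.
Qed.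

Lemma iterate_in_ball k : X k <= gamma ^+ 2 /\ D k <= gamma ^+ 2.
Proof.
have [_ h1 h2] := lalm_invariant k; have [h3 h4] := fejer_bounds h1.
split; first exact: le_trans W0_le.
apply: (le_trans h4); apply: le_trans W0_le_dual.
have W00 : 0 <= W0 by apply: le_trans h3; exact: dotv_ge0.
rewrite ler_wpM2r// ler_wpM2l ?divr_ge0 ?(ltW b0)//.
exact: le_trans (e_le_eta k) h2.
Qed.

Lemma kkt_strong_convexity u : dotv (u - xs) (u - xs) <= gamma ^+ 2 ->
  auglag_smooth P b xs ys zs + mu / 4 * dotv (u - xs) (u - xs)
  <= auglag_smooth P b u ys zs.
Proof.
move=> hu; have [dg df dgg dfg] := problem_regularity cP.
have := @auglag_strong_convexity _ _ _ _ P b b0 dg df dgg dfg J mu xs u ys zs.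
rewrite (auggrad_kkt b0 nd) dotv0l addr0; apply=> t /andP[t0 t1].
suff c : dotv (xs + t *: (u - xs) - xs) (xs + t *: (u - xs) - xs) <= gamma ^+ 2.
  by have [] := local_ball c (dotv_subrr_le ys) (dotv_subrr_le zs).
rewrite (addrC xs) addrK dotvZl dotvZr mulrA -expr2; apply: le_trans hu.
by rewrite ler_piMl ?dotv_ge0// expr_le1.
Qed.

(* Comparing strong convexity with the descent lemma along any direction. *)
Lemma modulus_le (v : 'cV[R]_p) : v != 0 -> mu <= 2 * eta_bar.
Proof.
move=> vn; have [[_ iX] _ _ _ _] := nd.
have vp : 0 < enorm v.
  rewrite lt_def enorm_ge0 andbT; apply: contra vn => /eqP h.
  by rewrite (enorm_eq0 h).
pose u := xs + (gamma / enorm v) *: v.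
have uE : dotv (u - xs) (u - xs) = gamma ^+ 2.
  rewrite /u (addrC xs) addrK dotvZl dotvZr -enorm_sq; field.
  by rewrite gt_eqF.
have c : dotv (u - xs) (u - xs) <= gamma ^+ 2 by rewrite uE.
have [iu _ _ _] := local_ball c (dotv_subrr_le ys) (dotv_subrr_le zs).
have h1 := kkt_strong_convexity c.
have := auglag_descent b0 cP lP ys zs (interior_subset iX) (interior_subset iu).
rewrite (auggrad_kkt b0 nd) dotv0l addr0 => h2.
have := le_trans h1 h2; rewrite lerD2l uE ler_pM2r ?exprn_gt0//.
have := lip_kkt_le; lra.
Qed.

Hypothesis mu0 : 0 < mu.
Hypothesis curvature_variation : forall (x1 x2 : 'cV[R]_p) (z1 z2 : 'cV[R]_m),
  enorm (x1 - xs) <= gamma -> enorm (x2 - xs) <= gamma ->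
  enorm (z1 - zs) <= gamma -> enorm (z2 - zs) <= gamma ->
  `| (\sum_(j in J) L j * (b * pf P j x1 + z1 j 0))
     - (\sum_(j in J) L j * (b * pf P j x2 + z2 j 0)) | <= mu / 8.

Lemma iterate_bounds k :
  [/\ dotv (x k - xs) (x k - xs) <= gamma ^+ 2,
      dotv (y k - ys) (y k - ys) <= gamma ^+ 2 &
      dotv (z k - zs) (z k - zs) <= gamma ^+ 2].
Proof.
have [h1 h2] := iterate_in_ball k; split=> //; apply: le_trans h2.
  by rewrite lerDl dotv_ge0.
by rewrite lerDr dotv_ge0.
Qed.

Lemma lip_iterate_active k : lip k =
  Lg + b * specnorm (pA P) ^+ 2 + \sum_j b * B j ^+ 2
  + \sum_(j in J) L j * (b * pf P j (x k) + z k j 0).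
Proof.
have [h1 h2 h3] := iterate_bounds k; have [_ act inact _] := local_ball h1 h2 h3.
rewrite /lip_const big_split /= addrA; congr (_ + _).
rewrite [RHS]big_mkcond; apply: eq_bigr => j _.
case: ifPn => jJ; first by rewrite max_r// ltW// act.
by rewrite max_l ?mulr0// ltW// inact.
Qed.

(** In the ball two values of [lip_const] differ only through the sum over J, hence by at most mu /
    8; as [eta k] is at least [lip k + delta], the running maximum rises by no more. *)
Lemma eta_succ_le k : eta k.+1 <= eta k + mu / 8.
Proof.
have [-> _ _ _] := alg k.+1; rewrite ge_max lerDl divr_ge0 ?(ltW mu0)//=.
rewrite lip_iterate_active.
have := eta_ge_lip k; rewrite lip_iterate_active.
have [h1 _ h3] := iterate_bounds k; have [h1' _ h3'] := iterate_bounds k.+1.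
have g0 := ltW gamma0.
have := @curvature_variation (x k.+1) (x k) (z k.+1) (z k).
rewrite !enorm_leP// => /(_ h1' h1 h3' h3) /ler_normlW.
move: (\sum_(j in J) _) (\sum_(j in J) _) => s1 s2; lra.
Qed.

Lemma Cconst_ge0 : 0 <= Cconst b Lg L B J zs gamma.
Proof.
have [_ LB _ _ _] := lP.
rewrite /Cconst addr_ge0 ?sqr_ge0// mulr_ge0 ?mulr_ge0// addr_ge0//.
  apply: sumr_ge0 => j _; rewrite mulr_ge0 ?sqr_ge0//.
  by rewrite exprn_ge0 ?(LB j).2.
by rewrite mulr_ge0 ?addr_ge0 ?sqr_ge0// mulr_ge0 ?sqr_ge0.
Qed.

Lemma lalm_contraction nu alpha sigma (v : 'cV[R]_p) : v != 0 ->
  smallest_eigenvalue ((constraint_mx P xs)^T *m constraint_mx P xs) nu ->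
  0 <= alpha ->
  alpha * (b * specnorm (pA P) ^+ 2) <= 1 -> alpha * eta_bar ^+ 2 <= delta ->
  (alpha * Cconst b Lg L B J zs gamma + eta_bar) / (mu / 8 + eta_bar) <= sigma ->
  1 - alpha * b * nu / 8 <= sigma -> sigma <= 1 -> forall k,
  (mu / 16 + eta k.+1 / 2) * dotv (x k.+1 - xs) (x k.+1 - xs)
    + b^-1 * (dotv (y k.+1 - ys) (y k.+1 - ys) + dotv (z k.+1 - zs) (z k.+1 - zs))
  <= sigma * ((mu / 16 + eta k / 2) * dotv (x k - xs) (x k - xs)
    + b^-1 * (dotv (y k - ys) (y k - ys) + dotv (z k - zs) (z k - zs))).
Proof.
move=> vn ev al0 alA aldel s1 s2 s3 k.
have [[[_ Axs kz] iX] hJ hN _ _] := nd.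
have [h1 h2 h3] := iterate_bounds k; have [h1' _ _] := iterate_bounds k.+1.
have [iXk act inact _] := local_ball h1 h2 h3.
(* Both gap identities compare two points at common multipliers, so the signs are needed at mixed
   triples: the new x or xs with the old multipliers, and the new x with (ys, zs). *)
have [iXk' act' inact' _] := local_ball h1' h2 h3.
have [_ acts inacts _] := local_ball (dotv_subrr_le xs) h2 h3.
have [_ actz inactz _] := local_ball h1' (dotv_subrr_le ys) (dotv_subrr_le zs).
have [_ _ y'E z'E] := alg k.
have [_ vi] := prox_optimality k.
have Xk := interior_subset iXk; have Xk' := interior_subset iXk'.
have [_ _ eb] := lalm_invariant k.
(* The new iterate is interior, so its variational inequality becomes an equation. *)
have stat : auggrad P b (x k) (y k) (z k) + eta k *: (x k.+1 - x k) = 0.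
  apply/eqP; rewrite -oppr_eq0; apply/eqP; apply: (interior_normal0 iXk') => u Xu.
  by rewrite dotvNl oppr_le0 vi.
have p1 := prox_step_decrease b0 cP lP Xk Xk' Axs (vi _ (interior_subset iX)).
have p2 := auglag_dual_step_active b0 nd y'E z'E act' inact' acts inacts.
have p3 := auglag_kkt_multipliers b0 nd actz inactz.
have p4 := kkt_strong_convexity h1'.
have p5 := dual_error_bound cP lP nd Xk stat act inact h3 ev.
have p6 := lagrangian_ge cP nd (x k.+1).
have sqE (w : 'cV[R]_m) : dotv w w =
    \sum_(j in J) w j 0 ^+ 2 + \sum_(j | j \notin J) w j 0 ^+ 2.
  rewrite dotvE (bigID (mem J)) /=.
  by congr (_ + _); apply: eq_bigr => j _; rewrite expr2.
have hDN : \sum_(j | j \notin J) (z k.+1 - zs) j 0 ^+ 2 =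
    (\sum_(j | j \notin J) (z k - zs) j 0 ^+ 2) / 4.
  rewrite mulr_suml; apply: eq_bigr => j jJ; rewrite !mxE z'E.
  have [_ ->] := hN j jJ; rewrite max_l.
    by field; rewrite gt_eqF.
  rewrite -mulNr ler_pdivlMr// mulrC -subr_le0 opprK.
  exact: ltW (inact' j jJ).
have sums0 (Q : pred 'I_m) (w : 'I_m -> R) : 0 <= \sum_(j | Q j) w j ^+ 2.
  by apply: sumr_ge0 => j _; exact: sqr_ge0.
have eb0 := eta_bar_gt0.
have mu2 := modulus_le vn.
have C0 := Cconst_ge0.
have den : 0 < mu / 8 + eta_bar by have := mu0; lra.
have s1' : alpha * Cconst b Lg L B J zs gamma + eta_bar <= sigma * (mu / 8 + eta_bar).
  by rewrite -ler_pdivrMr.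
(* From mu <= 2 eta_bar the first ratio is at least eta_bar / (mu / 8 + eta_bar) >= 4/5; this leaves
   room for the factor 1/4 off J. *)
have s4 : 1 / 4 <= sigma.
  rewrite -(ler_pM2r den); apply: le_trans s1'.
  by have := mulr_ge0 al0 C0; lra.
rewrite !(sqE (_ - zs)).
apply: (contraction_scalars (l := lip k) (eta_bar := eta_bar) (delta := delta)
  (C := Cconst b Lg L B J zs gamma) (nu := nu) (alpha := alpha)
  (a := specnorm (pA P))
  (rr := dotv (pA P *m x k - pb P) (pA P *m x k - pb P))
  (dd := dotv (x k.+1 - x k) (x k.+1 - x k))
  (Q := dotv (pA P *m x k.+1 - pb P) (pA P *m x k.+1 - pb P)
         + \sum_(j in J) pf P j (x k.+1) ^+ 2)
  (br := pg P (x k.+1) + dotv ys (pA P *m x k.+1 - pb P)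
         + \sum_j zs j 0 * pf P j (x k.+1) - pg P xs)
  _ _ _ _ _ _ _ _ _ _ _ _ _ _ _ p1 p2 _ p5 alA aldel (eta_ge_lip k) hDN
  (eta_succ_le k) s1' s2 s4 s3) => //; rewrite ?dotv_ge0 ?sums0 ?(ltW mu0)//.
- exact: ltW (eta_gt0 k).
- by rewrite addr_ge0 ?dotv_ge0.
- by rewrite subr_ge0 -addrA addrA.
- by rewrite -p3 lerBrDl.
Qed.

End Iterates.
Theorem theorem3p5 (R : realType) (p q m : nat) (P : problem R p q m)
    (Lg : R) (L B : 'I_m -> R)
    (xs : 'cV[R]_p) (ys : 'cV[R]_q) (zs : 'cV[R]_m) (J : {set 'I_m})
    (beta rho_y rho_z delta mu gamma nu eta_bar alpha : R)
    (x : nat -> 'cV[R]_p) (y : nat -> 'cV[R]_q) (z : nat -> 'cV[R]_m)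
    (eta : nat -> R) :
  convex_problem P ->
  lipschitz_assumption P Lg L B ->
  nondegenerate_kkt P xs ys zs J ->
  0 < beta -> rho_y = beta / 2 -> rho_z = beta / 2 -> 0 < delta ->
  0 < mu -> smallest_eigenvalue (hess_auglag P beta xs ys zs) mu ->
  0 < gamma -> local_radius P beta mu xs ys zs J gamma ->
  (forall (x1 x2 : 'cV[R]_p) (z1 z2 : 'cV[R]_m),
     enorm (x1 - xs) <= gamma -> enorm (x2 - xs) <= gamma ->
     enorm (z1 - zs) <= gamma -> enorm (z2 - zs) <= gamma ->
     `| (\sum_(j in J) L j * (beta * pf P j x1 + z1 j 0))
        - (\sum_(j in J) L j * (beta * pf P j x2 + z2 j 0)) | <= mu / 8) ->
  lalm P beta rho_y rho_z delta Lg L B x y z eta ->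
  eta_bar_rhs P beta rho_y rho_z delta Lg L B xs ys zs
    (x 0%N) (y 0%N) (z 0%N) (eta 0%N) eta_bar <= eta_bar ->
  let eta_lo := eta_low P beta Lg B in
  ((enorm (x 0%N - xs) ^+ 2)%:E
     + 1 / (rho_y * eta_lo)%:E * (enorm (y 0%N - ys) ^+ 2)%:E
     + 1 / (rho_z * eta_lo)%:E * (enorm (z 0%N - zs) ^+ 2)%:E
   <= (gamma ^+ 2)%:E
        * mine 1 (mine (1 / (rho_y * eta_bar)%:E)
                       (1 / (rho_z * eta_bar)%:E)))%E ->
  0 < nu ->
  smallest_eigenvalue ((constraint_mx P xs)^T *m constraint_mx P xs) nu ->
  let C := Cconst beta Lg L B J zs gamma in
  0 < alpha ->
  (alpha%:E < mine (mu%:E / (8 * C)%:E)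
                   (mine (delta%:E / (eta_bar ^+ 2)%:E)
                         (1 / (beta * specnorm (pA P) ^+ 2)%:E)))%E ->
  let phi k :=
    (mu / 16 + eta k / 2) * enorm (x k - xs) ^+ 2
      + beta^-1 * (enorm (y k - ys) ^+ 2 + enorm (z k - zs) ^+ 2) in
  let sigma := Num.max ((alpha * C + eta_bar) / (mu / 8 + eta_bar))
                       (1 - alpha * beta * nu / 8) in
  sigma < 1 /\ forall k, phi k.+1 <= sigma * phi k.
Proof.
move=> cP lP nd b0 -> -> delta0 mu0 ev_mu gamma0 lr curv alg eta_bar_ge eta_lo.
move=> init nu0 ev C alpha0 alpha_lt phi sigma.
have eb0 := eta_bar_gt0 b0 lP delta0 eta_bar_ge.
have eta00 := eta_gt0 b0 lP delta0 alg 0%N.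
have lo0 : 0 <= eta_lo.
  have [h1 _ _ h2] := rhs_terms_ge0 b0 lP.
  by rewrite /eta_lo /eta_low -mulr_sumr addr_ge0// mulr_ge0// ltW.
(* Hence the initial condition, weighted by 1 / eta_lo, also bounds W0, weighted by 1 / eta^0. *)
have lo_le : eta_lo <= eta 0%N.
  have := eta_ge_lip alg 0%N; rewrite /lip_const big_split /= addrA => h.
  have [_ LB _ _ _] := lP.
  have s0 : 0 <= \sum_j L j * Num.max 0 (beta * pf P j (x 0%N) + z 0%N j 0).
    by apply: sumr_ge0 => j _; rewrite mulr_ge0 ?(LB j).1// le_max lexx.
  by move: h s0; rewrite /eta_lo /eta_low; lra.
have r0 : 0 < beta / 2 by rewrite divr_gt0.
have reta : 0 < beta / 2 * eta 0%N by rewrite mulr_gt0.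
have rbar : 0 < beta / 2 * eta_bar by rewrite mulr_gt0.
have rlo0 : 0 <= beta / 2 * eta_lo by rewrite mulr_ge0// ltW.
have rlo_le : beta / 2 * eta_lo <= beta / 2 * eta 0%N by rewrite ler_pM2l.
pose W0 := enorm (x 0%N - xs) ^+ 2
  + (enorm (y 0%N - ys) ^+ 2 + enorm (z 0%N - zs) ^+ 2) / (beta / 2 * eta 0%N).
(* The 1 in the minimum will confine the primal iterates to the ball, the other entry the
   multipliers. *)
have W_init : W0 <= gamma ^+ 2 * Num.min 1 (beta / 2 * eta_bar)^-1.
  rewrite -lee_fin; apply: le_trans (le_trans init _).
    rewrite /W0 mulrDl addrA !EFinD !leeD//.
      exact: ler_one_div rlo0 rlo_le reta (sqr_ge0 _).
    exact: ler_one_div rlo0 rlo_le reta (sqr_ge0 _).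
  by rewrite minxx inver gt_eqF// mul1e -EFin_min -EFinM.
have W_gamma : W0 <= gamma ^+ 2.
  by apply: (le_trans W_init); rewrite ler_piMr ?sqr_ge0// ge_min lexx.
have W_dual : beta / 2 * eta_bar * W0 <= gamma ^+ 2.
  rewrite -ler_pdivlMl// mulrC; apply: (le_trans W_init).
  by rewrite ler_wpM2l ?sqr_ge0// ge_min lexx orbT.
have C0 : 0 <= C by exact: Cconst_ge0 lP.
move: alpha_lt; rewrite !lt_min => /and3P[].
move=> /(lte_div_mul mu0 (mulr_ge0 (ler0n _ _) C0)) aC.
move=> /(lte_div_mul delta0 (sqr_ge0 _)) adelta.
have bA0 : 0 <= beta * specnorm (pA P) ^+ 2 by rewrite mulr_ge0 ?sqr_ge0 ?ltW.
move=> /(lte_div_mul ltr01 bA0) aA.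
have den : 0 < mu / 8 + eta_bar by lra.
have sigma1 : sigma < 1.
  rewrite /sigma gt_max ltr_pdivrMr// mul1r ltrD2r gtrDl oppr_lt0.
  apply/andP; split; first by lra.
  by rewrite divr_gt0// !mulr_gt0.
split=> // k; rewrite /phi !enorm_sq.
(* An eigenvector for mu shows that the primal space is nonzero, which the comparison of mu with
   eta_bar requires. *)
have [v vn] : exists v : 'cV[R]_p, v != 0.
  have [/eigenvalueP[w _ wn] _] := ev_mu; exists w^T.
  by apply: contra wn => /eqP h; rewrite -[w]trmxK h trmx0.
apply: (lalm_contraction b0 cP lP nd delta0 gamma0 lr alg eta_bar_ge W_gamma W_dual
  mu0 curv vn ev (ltW alpha0) (ltW aA) (ltW adelta)).
- by rewrite /sigma le_max lexx.
- by rewrite /sigma le_max lexx orbT.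
- exact: ltW.
Qed.
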